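(* Let $\beta_1,\beta_2\ge 0$ and for each $n$ let $\mathbf{X}\sim\mathbb{P}_{\beta_1,\mathbf{Q}^{\mathrm{CW}}}$ and $\mathbf{Y}\sim\mathbb{P}_{\beta_2,\mathbf{Q}^{\mathrm{CW}}}$ be independent. Then $$\sqrt{n}\,T_n\xrightarrow{d} N\big(0,(1-m_1^2)(1-m_2^2)\big),$$ where for $i=1,2$, $m_i=0$ if $\beta_i\le 1$ and otherwise $m_i$ is the unique positive root of $m=\tanh(\beta_i m)$. In particular the limiting variance equals $1$ if and only if $\beta_1,\beta_2\le1$, and is strictly less than $1$ otherwise.
   Context: Ising model: for an $n\times n$ symmetric matrix $\mathbf{Q}_n$ with zero diagonal and $\beta\ge0$, $\mathbb{P}_{\beta,\mathbf{Q}_n}(\mathbf{Z}=\mathbf{z})=Z(\beta,\mathbf{Q}_n)^{-1}\exp\big(\tfrac{\beta}{2}\mathbf{z}^\top\mathbf{Q}_n\mathbf{z}\big)$ for $\mathbf{z}\in\{\pm1\}^n$. Curie–Weiss model: $\mathbf{Q}^{\mathrm{CW}}=\frac1n(\mathbf{1}\mathbf{1}^\top-I_n)$. Sample covariance: $T_n=\frac1n\sum_{i=1}^n (X_i-\overline{\mathbf{X}}_n)(Y_i-\overline{\mathbf{Y}}_n)$ with $\overline{\mathbf{X}}_n,\overline{\mathbf{Y}}_n$ the sample means. *)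

(* Defs.v *)
From Stdlib Require Import Reals List Arith.
From Coquelicot Require Import Coquelicot.
Open Scope R_scope.

Definition tanh (x : R) : R := (exp x - exp (- x)) / (exp x + exp (- x)).

Fixpoint sum_upto (n : nat) (f : nat -> R) : R :=
  match n with O => 0 | S k => sum_upto k f + f k end.

Definition sumR (l : list R) : R := fold_right Rplus 0 l.

Fixpoint spins (n : nat) : list (list R) :=
  match n with
  | O => nil :: nil
  | S k => map (cons 1) (spins k) ++ map (cons (-1)) (spins k)
  end.

Definition coord (z : list R) (i : nat) : R := nth i z 0.

Definition quad_form (n : nat) (Q : nat -> nat -> R) (z : list R) : R :=
  sum_upto n (fun i => sum_upto n (fun j => Q i j * coord z i * coord z j)).

Definition ising_weight (n : nat) (beta : R) (Q : nat -> nat -> R) (z : list R) : R :=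
  exp (beta / 2 * quad_form n Q z).

Definition partition_fn (n : nat) (beta : R) (Q : nat -> nat -> R) : R :=
  sumR (map (ising_weight n beta Q) (spins n)).

Definition ising_pmf (n : nat) (beta : R) (Q : nat -> nat -> R) (z : list R) : R :=
  ising_weight n beta Q z / partition_fn n beta Q.

Definition Q_CW (n : nat) (i j : nat) : R :=
  if Nat.eqb i j then 0 else 1 / INR n.

Definition sample_mean (n : nat) (z : list R) : R := sum_upto n (coord z) / INR n.

Definition T_n (n : nat) (x y : list R) : R :=
  (1 / INR n) * sum_upto n (fun i =>
     (coord x i - sample_mean n x) * (coord y i - sample_mean n y)).

Definition expect_scaled_cov (n : nat) (beta1 beta2 : R) (f : R -> R) : R :=
  sumR (map (fun x =>
    sumR (map (fun y =>
      ising_pmf n beta1 (Q_CW n) x * ising_pmf n beta2 (Q_CW n) y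
        * f (sqrt (INR n) * T_n n x y)) (spins n))) (spins n)).

Definition normal_density (v : R) (x : R) : R :=
  exp (- (x * x) / (2 * v)) / sqrt (2 * PI * v).

Definition converges_in_dist_to_normal (E : nat -> (R -> R) -> R) (v : R) : Prop :=
  forall f : R -> R,
    (forall x, continuous f x) -> (exists M, forall x, Rabs (f x) <= M) ->
    exists L : R,
      is_RInt_gen (fun x => f x * normal_density v x)
        (Rbar_locally m_infty) (Rbar_locally p_infty) L
      /\ is_lim_seq (fun n => E n f) L.

Definition cw_magnetization (beta m : R) : Prop :=
  (beta <= 1 -> m = 0) /\ (1 < beta -> 0 < m /\ m = tanh (beta * m)).

(* Main.v *)
(* The weight of [X] depends only on its spin sum, so exchanging two spins [i], [j] of [X]
   preserves the law and moves [W = sqrt n * T_n] by [- D_ij / sqrt n], where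
   [D_ij = (X_i - X_j) (Y_i - Y_j)]. Since [sum D_ij = 2 n^2 T_n] and [sum D_ij^2 = 4 n^2 A_n] with
   [A_n = 1 - Xbar^2 - Ybar^2 + (T_n + Xbar Ybar)^2], antisymmetry gives Stein's identity
   [E (W g(W)) = E (A_n g'(W)) + o(1)]. The sample means satisfy [Xbar^2 -> m1^2] and
   [Ybar^2 -> m2^2] in mean, by a Chernoff bound at each of the [n + 1] possible values of the
   magnetization, so [A_n -> v = (1 - m1^2) (1 - m2^2)]. For a continuous [h] with compact support
   and zero mean under [N(0, v)], the solution [g] of [v g' - w g = h] has compact support, hence
   [E h(W) -> 0]. Truncation and [E W^2 <= 4] extend this to bounded continuous functions. *)
Require Import Defs.
From Stdlib Require Import Reals Lra Lia List Arith Permutation.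
From Coquelicot Require Import Coquelicot.
Open Scope R_scope.

(** * Sums over spin configurations *)

(** The obstacle is the correction [sqrt n * Xbar * Ybar] inside [W]. At the critical values the
    sample means have size [n^(-1/4)], and for [beta > 1] they stay near [m] or [-m], so this
    product is not negligible and [W] cannot be replaced by the uncentred sum. Exchanging two spins,
    unlike flipping one, keeps both sample means fixed and so treats [W] as a whole; what is then
    asked of the means is a law of large numbers for their squares, uniformly in all temperature
    regimes. Squares are the right quantity, because above criticality the law of [Xbar] has two
    symmetric peaks. For [beta < 1] the Chernoff bound is taken at the inverse temperature 1, since
    the rate function for [beta = 0] is constant and has no peak. The compact support of [g'] gives
    both a bound and a uniform modulus of continuity. The modulus controls the Taylor remainder in
    Stein's identity with a single derivative of [g], and the bound turns convergence of [A_n] in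
    mean into convergence of [E (A_n g'(W))]. *)

Lemma sum_upto_ext (n : nat) (f g : nat -> R) :
  (forall i, (i < n)%nat -> f i = g i) -> sum_upto n f = sum_upto n g.
Proof.
  induction n as [|n IH]; simpl; intros H; [easy|].
  rewrite IH, (H n) by auto with arith. easy.
Qed.

Lemma sum_upto_plus (n : nat) (f g : nat -> R) :
  sum_upto n (fun i => f i + g i) = sum_upto n f + sum_upto n g.
Proof. induction n as [|n IH]; simpl; [|rewrite IH]; ring. Qed.

Lemma sum_upto_scal (n : nat) (c : R) (f : nat -> R) :
  sum_upto n (fun i => c * f i) = c * sum_upto n f.
Proof. induction n as [|n IH]; simpl; [|rewrite IH]; ring. Qed.

Lemma sum_upto_const (n : nat) (c : R) : sum_upto n (fun _ => c) = INR n * c.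
Proof.
  induction n as [|n IH]; [simpl; ring|].
  rewrite S_INR; cbn [sum_upto]; rewrite IH; ring.
Qed.

Lemma sum_upto_le (n : nat) (f g : nat -> R) :
  (forall i, (i < n)%nat -> f i <= g i) -> sum_upto n f <= sum_upto n g.
Proof.
  induction n as [|n IH]; simpl; intros H; [lra|].
  apply Rplus_le_compat; auto with arith.
Qed.

Lemma sum_upto_Rabs (n : nat) (f : nat -> R) :
  Rabs (sum_upto n f) <= sum_upto n (fun i => Rabs (f i)).
Proof.
  induction n as [|n IH]; simpl; [rewrite Rabs_R0; lra|].
  eapply Rle_trans; [apply Rabs_triang|lra].
Qed.

Lemma sum_upto_ge_term (n k : nat) (f : nat -> R) :
  (forall i, (i < n)%nat -> 0 <= f i) -> (k < n)%nat -> f k <= sum_upto n f.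
Proof.
  induction n as [|n IH]; simpl; intros Hf Hk; [lia|].
  assert (H0 : 0 <= sum_upto n f).
  { rewrite <- (Rmult_0_r (INR n)), <- (sum_upto_const n 0).
    apply sum_upto_le; auto with arith. }
  pose proof (Hf n (Nat.lt_succ_diag_r n)).
  destruct (Nat.eq_dec k n) as [->|]; [lra|].
  assert (f k <= sum_upto n f) by (apply IH; auto with arith; lia). lra.
Qed.

(** Both the exchange of two spins and the zero diagonal of [Q_CW] enter sums as a change of one
    term. *)
Lemma sum_upto_update (n i : nat) (a : R) (f : nat -> R) : (i < n)%nat ->
  sum_upto n (fun k => if Nat.eqb k i then a else f k) = sum_upto n f + (a - f i).
Proof.
  induction n as [|n IH]; simpl; intros Hi; [lia|].
  destruct (Nat.eqb_spec n i) as [->|Hn].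
  - rewrite (sum_upto_ext i _ f); [ring|].
    intros k Hk; destruct (Nat.eqb_spec k i); [lia|easy].
  - rewrite IH by lia; ring.
Qed.

Lemma sum_upto_cons (n : nat) (a : R) (z : list R) :
  sum_upto (S n) (coord (a :: z)) = a + sum_upto n (coord z).
Proof.
  induction n as [|n IH]; [unfold coord; simpl; ring|].
  cbn [sum_upto] in *; rewrite IH; unfold coord; simpl; ring.
Qed.

Lemma sumR_app (l l' : list R) : sumR (l ++ l') = sumR l + sumR l'.
Proof. induction l as [|a l IH]; simpl; [|rewrite IH]; ring. Qed.

Lemma sumR_Permutation (l l' : list R) : Permutation l l' -> sumR l = sumR l'.
Proof. induction 1; simpl; lra. Qed.

Lemma sumR_map_ext {A : Type} (l : list A) (F G : A -> R) :
  (forall x, In x l -> F x = G x) -> sumR (map F l) = sumR (map G l).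
Proof. intros H; f_equal; apply map_ext_in, H. Qed.

Lemma sumR_map_le {A : Type} (l : list A) (F G : A -> R) :
  (forall x, In x l -> F x <= G x) -> sumR (map F l) <= sumR (map G l).
Proof.
  induction l as [|a l IH]; simpl; intros H; [lra|].
  apply Rplus_le_compat; auto.
Qed.

Lemma sumR_map_plus {A : Type} (l : list A) (F G : A -> R) :
  sumR (map (fun x => F x + G x) l) = sumR (map F l) + sumR (map G l).
Proof. induction l as [|a l IH]; simpl; [|rewrite IH]; ring. Qed.

Lemma sumR_map_scal {A : Type} (l : list A) (c : R) (F : A -> R) :
  sumR (map (fun x => c * F x) l) = c * sumR (map F l).
Proof. induction l as [|a l IH]; simpl; [|rewrite IH]; ring. Qed.

Lemma sumR_map_sum_upto {A : Type} (l : list A) (n : nat) (F : nat -> A -> R) :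
  sumR (map (fun x => sum_upto n (fun i => F i x)) l)
  = sum_upto n (fun i => sumR (map (F i) l)).
Proof.
  induction n as [|n IH]; simpl; [induction l; simpl; lra|].
  rewrite sumR_map_plus, IH; easy.
Qed.

Lemma sumR_map_exchange {A B : Type} (l : list A) (l' : list B) (F : A -> B -> R) :
  sumR (map (fun x => sumR (map (F x) l')) l)
  = sumR (map (fun y => sumR (map (fun x => F x y) l)) l').
Proof.
  induction l as [|a l IH]; simpl.
  - induction l'; simpl; lra.
  - rewrite IH, <- sumR_map_plus; easy.
Qed.

Lemma in_spins (n : nat) (z : list R) :
  In z (spins n) <-> length z = n /\ forall a, In a z -> a = 1 \/ a = -1.
Proof.
  revert z; induction n as [|n IH]; simpl; intros z.
  - split; [intros [<-|[]]; simpl; tauto|].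
    intros [H _]; left; destruct z; [easy|discriminate].
  - rewrite in_app_iff, !in_map_iff; split.
    + intros [(z' & <- & H)|(z' & <- & H)]; apply IH in H as [H1 H2]; simpl; split;
        try lia; intros a [<-|Ha]; auto.
    + intros [H1 H2]; destruct z as [|b z]; [discriminate|].
      assert (Hz : In z (spins n)).
      { apply IH; split; [simpl in H1; lia|intros a Ha; apply H2; now right]. }
      destruct (H2 b (or_introl eq_refl)) as [-> | ->]; [left|right]; now exists z.
Qed.

Lemma NoDup_spins (n : nat) : NoDup (spins n).
Proof.
  induction n as [|n IH]; simpl; [constructor; [easy|constructor]|].
  apply NoDup_app.
  - apply FinFun.Injective_map_NoDup; [|easy]. intros u w H; now injection H.
  - apply FinFun.Injective_map_NoDup; [|easy]. intros u w H; now injection H.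
  - intros z H1 H2; apply in_map_iff in H1 as (z1 & <- & _).
    apply in_map_iff in H2 as (z2 & H & _). injection H; lra.
Qed.

Lemma coord_spins (n i : nat) (z : list R) :
  In z (spins n) -> (i < n)%nat -> coord z i = 1 \/ coord z i = -1.
Proof.
  intros Hz Hi; apply in_spins in Hz as [H1 H2].
  apply H2, nth_In; lia.
Qed.

Lemma coord_spins_sqr (n i : nat) (z : list R) :
  In z (spins n) -> (i < n)%nat -> coord z i * coord z i = 1.
Proof. intros Hz Hi; destruct (coord_spins n i z Hz Hi) as [-> | ->]; ring. Qed.

(** * Exchanging two spins *)

Definition transpose (i j k : nat) : nat :=
  if Nat.eqb k i then j else if Nat.eqb k j then i else k.

Lemma transpose_involutive (i j k : nat) : transpose i j (transpose i j k) = k.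
Proof.
  unfold transpose; destruct (Nat.eqb_spec k i); subst.
  - destruct (Nat.eqb_spec j i); subst; [easy|]. now rewrite Nat.eqb_refl.
  - destruct (Nat.eqb_spec k j); subst; [now rewrite Nat.eqb_refl|].
    destruct (Nat.eqb_spec k i); [easy|]. destruct (Nat.eqb_spec k j); easy.
Qed.

Lemma transpose_lt (n i j k : nat) :
  (i < n)%nat -> (j < n)%nat -> (k < n)%nat -> (transpose i j k < n)%nat.
Proof.
  unfold transpose; destruct (Nat.eqb k i); destruct (Nat.eqb k j); easy.
Qed.

(** Rebuilding the list from its coordinates gives length [n] by construction, and [coord] of the
    result reduces to [coord] of the original. *)
Definition swap (n i j : nat) (z : list R) : list R :=
  map (fun k => coord z (transpose i j k)) (seq 0 n).

Lemma coord_swap (n i j k : nat) (z : list R) :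
  (k < n)%nat -> coord (swap n i j z) k = coord z (transpose i j k).
Proof.
  intros Hk; unfold swap; unfold coord at 1.
  (* [map_nth] wants a default of the form [f d], so 0 is replaced by the image of index 0. *)
  rewrite (nth_indep _ 0 (coord z (transpose i j 0))) by (rewrite length_map, length_seq; easy).
  rewrite (map_nth (fun k => coord z (transpose i j k))), seq_nth by easy. easy.
Qed.

Lemma swap_in_spins (n i j : nat) (z : list R) :
  (i < n)%nat -> (j < n)%nat -> In z (spins n) -> In (swap n i j z) (spins n).
Proof.
  intros Hi Hj Hz; apply in_spins; unfold swap; split.
  - now rewrite length_map, length_seq.
  - intros a Ha; apply in_map_iff in Ha as (k & <- & Hk); apply in_seq in Hk.
    apply (coord_spins n); [easy|apply transpose_lt; lia].
Qed.

Lemma swap_involutive (n i j : nat) (z : list R) :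
  (i < n)%nat -> (j < n)%nat -> In z (spins n) -> swap n i j (swap n i j z) = z.
Proof.
  intros Hi Hj Hz; apply in_spins in Hz as [Hl _].
  apply (nth_ext _ _ 0 0); unfold swap at 1; rewrite length_map, length_seq; [easy|].
  intros k Hk; change (coord (swap n i j (swap n i j z)) k = coord z k).
  rewrite !coord_swap by (try apply transpose_lt; easy).
  now rewrite transpose_involutive.
Qed.

(** An involution that maps the duplicate-free list [spins n] into itself permutes it. *)
Lemma sum_spins_swap (n i j : nat) (F : list R -> R) :
  (i < n)%nat -> (j < n)%nat ->
  sumR (map (fun z => F (swap n i j z)) (spins n)) = sumR (map F (spins n)).
Proof.
  intros Hi Hj; rewrite <- (map_map (swap n i j) F).
  apply sumR_Permutation, Permutation_map, NoDup_Permutation.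
  - apply NoDup_map_NoDup_ForallPairs; [|apply NoDup_spins].
    intros u w Hu Hw H.
    rewrite <- (swap_involutive n i j u), <- (swap_involutive n i j w) by easy.
    now rewrite H.
  - apply NoDup_spins.
  - intros z; rewrite in_map_iff; split.
    + intros (u & <- & Hu); now apply swap_in_spins.
    + intros Hz; exists (swap n i j z); split; [now apply swap_involutive|].
      now apply swap_in_spins.
Qed.

(** [f] also sees the index, so that the sum of [x_k * y_k] with [y] held fixed is covered. For
    [i = j] the correction terms vanish. *)
Lemma sum_upto_swap (n i j : nat) (f : R -> nat -> R) (z : list R) :
  (i < n)%nat -> (j < n)%nat ->
  sum_upto n (fun k => f (coord (swap n i j z) k) k)
  = sum_upto n (fun k => f (coord z k) k)
    + (f (coord z j) i - f (coord z i) i) + (f (coord z i) j - f (coord z j) j).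
Proof.
  intros Hi Hj; destruct (Nat.eq_dec i j) as [->|Hij].
  - rewrite (sum_upto_ext n _ (fun k => f (coord z k) k)); [ring|].
    intros k Hk; rewrite coord_swap by easy; unfold transpose.
    destruct (Nat.eqb_spec k j); subst; easy.
  - rewrite (sum_upto_ext n _ (fun k => if Nat.eqb k i then f (coord z j) i
        else if Nat.eqb k j then f (coord z i) j else f (coord z k) k)).
    + rewrite sum_upto_update, sum_upto_update by easy.
      destruct (Nat.eqb_spec i j); [easy|ring].
    + intros k Hk; rewrite coord_swap by easy; unfold transpose.
      destruct (Nat.eqb_spec k i); subst; [easy|].
      destruct (Nat.eqb_spec k j); subst; easy.
Qed.

Lemma sum_coord_swap (n i j : nat) (z : list R) : (i < n)%nat -> (j < n)%nat ->
  sum_upto n (coord (swap n i j z)) = sum_upto n (coord z).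
Proof.
  intros Hi Hj; pose proof (sum_upto_swap n i j (fun a _ => a) z Hi Hj) as H.
  cbv beta in H; eapply eq_trans; [exact H|].
  change (fun k => coord z k) with (coord z); ring.
Qed.

(** Expectation under the product of the laws [p] and [q]. For Ising laws it is convertible with
    [expect_scaled_cov], which later proofs exploit through [change]. *)
Definition expect2 (n : nat) (p q : list R -> R) (F : list R -> list R -> R) : R :=
  sumR (map (fun x => sumR (map (fun y => p x * q y * F x y) (spins n))) (spins n)).

Definition pmf_on (n : nat) (p : list R -> R) : Prop :=
  (forall z, In z (spins n) -> 0 <= p z) /\ sumR (map p (spins n)) = 1.

Lemma expect2_ext (n : nat) (p q : list R -> R) (F G : list R -> list R -> R) :
  (forall x y, In x (spins n) -> In y (spins n) -> F x y = G x y) ->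
  expect2 n p q F = expect2 n p q G.
Proof.
  intros H; apply sumR_map_ext; intros x Hx; apply sumR_map_ext; intros y Hy.
  now rewrite H.
Qed.

Lemma expect2_plus (n : nat) (p q : list R -> R) (F G : list R -> list R -> R) :
  expect2 n p q (fun x y => F x y + G x y) = expect2 n p q F + expect2 n p q G.
Proof.
  unfold expect2; rewrite <- sumR_map_plus; apply sumR_map_ext; intros x _.
  rewrite <- sumR_map_plus; apply sumR_map_ext; intros; ring.
Qed.

Lemma expect2_scal (n : nat) (p q : list R -> R) (c : R) (F : list R -> list R -> R) :
  expect2 n p q (fun x y => c * F x y) = c * expect2 n p q F.
Proof.
  unfold expect2; rewrite <- sumR_map_scal; apply sumR_map_ext; intros x _.
  rewrite <- sumR_map_scal; apply sumR_map_ext; intros; ring.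
Qed.

Lemma expect2_sum_upto (n m : nat) (p q : list R -> R) (F : nat -> list R -> list R -> R) :
  expect2 n p q (fun x y => sum_upto m (fun i => F i x y))
  = sum_upto m (fun i => expect2 n p q (F i)).
Proof.
  unfold expect2; rewrite <- sumR_map_sum_upto; apply sumR_map_ext; intros x _.
  rewrite <- sumR_map_sum_upto; apply sumR_map_ext; intros y _.
  now rewrite sum_upto_scal.
Qed.

Lemma expect2_le (n : nat) (p q : list R -> R) (F G : list R -> list R -> R) :
  pmf_on n p -> pmf_on n q ->
  (forall x y, In x (spins n) -> In y (spins n) -> F x y <= G x y) ->
  expect2 n p q F <= expect2 n p q G.
Proof.
  intros [Hp _] [Hq _] H; apply sumR_map_le; intros x Hx; apply sumR_map_le; intros y Hy.
  apply Rmult_le_compat_l; auto using Rmult_le_pos.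
Qed.

Lemma expect2_fst (n : nat) (p q : list R -> R) (F : list R -> R) :
  pmf_on n q -> expect2 n p q (fun x _ => F x) = sumR (map (fun x => p x * F x) (spins n)).
Proof.
  intros [_ Hq]; apply sumR_map_ext; intros x _.
  rewrite (sumR_map_ext _ _ (fun y => (p x * F x) * q y)) by (intros; ring).
  rewrite sumR_map_scal, Hq; ring.
Qed.

Lemma expect2_snd (n : nat) (p q : list R -> R) (F : list R -> R) :
  pmf_on n p -> expect2 n p q (fun _ y => F y) = sumR (map (fun y => q y * F y) (spins n)).
Proof.
  intros [_ Hp]; unfold expect2; rewrite sumR_map_exchange.
  apply sumR_map_ext; intros y _.
  rewrite (sumR_map_ext _ _ (fun x => (q y * F y) * p x)) by (intros; ring).
  rewrite sumR_map_scal, Hp; ring.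
Qed.

Lemma expect2_const (n : nat) (p q : list R -> R) (c : R) :
  pmf_on n p -> pmf_on n q -> expect2 n p q (fun _ _ => c) = c.
Proof.
  intros [_ Hp] Hq; rewrite expect2_fst by easy.
  rewrite (sumR_map_ext _ _ (fun x => c * p x)) by (intros; ring).
  rewrite sumR_map_scal, Hp; ring.
Qed.

Lemma expect2_Rabs_le (n : nat) (p q : list R -> R) (F G : list R -> list R -> R) :
  pmf_on n p -> pmf_on n q ->
  (forall x y, In x (spins n) -> In y (spins n) -> Rabs (F x y) <= G x y) ->
  Rabs (expect2 n p q F) <= expect2 n p q G.
Proof.
  intros Hp Hq H; apply Rabs_le; split.
  - replace (- expect2 n p q G) with (expect2 n p q (fun x y => -1 * G x y))
      by (rewrite expect2_scal; ring).
    apply expect2_le; try easy; intros x y Hx Hy.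
    destruct (Rabs_le_between (F x y) (G x y)) as [K _]; specialize (K (H x y Hx Hy)); lra.
  - apply expect2_le; try easy; intros x y Hx Hy.
    eapply Rle_trans; [apply Rle_abs|auto].
Qed.

(** * Exchangeable pairs and Stein's identity *)

Definition spin_gap (x y : list R) (i j : nat) : R :=
  (coord x i - coord x j) * (coord y i - coord y j).

Definition W_n (n : nat) (x y : list R) : R := sqrt (INR n) * T_n n x y.

Definition A_n (n : nat) (x y : list R) : R :=
  1 - sample_mean n x ^ 2 - sample_mean n y ^ 2
  + (T_n n x y + sample_mean n x * sample_mean n y) ^ 2.

Lemma INR_gt_0 (n : nat) : (0 < n)%nat -> 0 < INR n.
Proof. intros Hn; now apply lt_0_INR. Qed.

Lemma T_n_eq (n : nat) (x y : list R) : (0 < n)%nat ->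
  T_n n x y = sum_upto n (fun i => coord x i * coord y i) / INR n
              - sample_mean n x * sample_mean n y.
Proof.
  intros Hn; apply INR_gt_0 in Hn; unfold T_n.
  rewrite (sum_upto_ext n _ (fun i => (coord x i * coord y i
     + (- sample_mean n y) * coord x i) + ((- sample_mean n x) * coord y i
     + sample_mean n x * sample_mean n y))) by (intros; ring).
  rewrite !sum_upto_plus, !sum_upto_scal, sum_upto_const.
  change (fun i => coord x i) with (coord x); change (fun i => coord y i) with (coord y).
  unfold sample_mean; field; lra.
Qed.

Lemma sum_spin_gap (n : nat) (x y : list R) : (0 < n)%nat ->
  sum_upto n (fun i => sum_upto n (fun j => spin_gap x y i j)) = 2 * INR n ^ 2 * T_n n x y.
Proof.
  intros Hn; rewrite T_n_eq by easy; apply INR_gt_0 in Hn.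
  set (P := sum_upto n (fun i => coord x i * coord y i)).
  set (X := sum_upto n (coord x)); set (Y := sum_upto n (coord y)).
  rewrite (sum_upto_ext n _ (fun i => (INR n * (coord x i * coord y i) + (- Y) * coord x i)
     + ((- X) * coord y i + P))).
  - rewrite !sum_upto_plus, !sum_upto_scal, sum_upto_const.
    change (fun i => coord x i) with (coord x); change (fun i => coord y i) with (coord y).
    unfold sample_mean; fold X Y P; field; lra.
  - intros i _; unfold spin_gap.
    rewrite (sum_upto_ext n _ (fun j => (coord x i * coord y i + (- coord x i) * coord y j)
      + ((- coord y i) * coord x j + coord x j * coord y j))) by (intros; ring).
    rewrite !sum_upto_plus, !sum_upto_scal, sum_upto_const.
    change (fun i => coord x i) with (coord x); change (fun i => coord y i) with (coord y).
    fold X Y P; ring.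
Qed.

(** For spins, [(x_i - x_j)^2 = 2 - 2 x_i x_j], so each squared gap is
    [4 (1 - x_i x_j) (1 - y_i y_j)]; the four resulting double sums are squares of single sums. *)
Lemma sum_spin_gap_sqr (n : nat) (x y : list R) :
  (0 < n)%nat -> In x (spins n) -> In y (spins n) ->
  sum_upto n (fun i => sum_upto n (fun j => spin_gap x y i j ^ 2))
  = 4 * INR n ^ 2 * A_n n x y.
Proof.
  intros Hn Hx Hy; unfold A_n; rewrite T_n_eq by easy; apply INR_gt_0 in Hn.
  set (P := sum_upto n (fun i => coord x i * coord y i)).
  set (X := sum_upto n (coord x)); set (Y := sum_upto n (coord y)).
  rewrite (sum_upto_ext n _ (fun i => (4 * INR n + (-4 * X) * coord x i)
     + ((-4 * Y) * coord y i + 4 * P * (coord x i * coord y i)))).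
  - rewrite !sum_upto_plus, !sum_upto_scal, sum_upto_const.
    change (fun i => coord x i) with (coord x); change (fun i => coord y i) with (coord y).
    unfold sample_mean; fold X Y P; field; lra.
  - intros i Hi; unfold spin_gap.
    rewrite (sum_upto_ext n _ (fun j => (4 + (-4 * coord x i) * coord x j)
      + ((-4 * coord y i) * coord y j
         + 4 * (coord x i * coord y i) * (coord x j * coord y j)))).
    + rewrite !sum_upto_plus, !sum_upto_scal, sum_upto_const.
      change (fun i => coord x i) with (coord x); change (fun i => coord y i) with (coord y).
      fold X Y P; ring.
    + intros j Hj.
      destruct (coord_spins n i x Hx Hi) as [-> | ->], (coord_spins n i y Hy Hi) as [-> | ->],
        (coord_spins n j x Hx Hj) as [-> | ->], (coord_spins n j y Hy Hj) as [-> | ->]; ring.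
Qed.

Lemma spin_gap_bound (n i j : nat) (x y : list R) :
  In x (spins n) -> In y (spins n) -> (i < n)%nat -> (j < n)%nat ->
  Rabs (spin_gap x y i j) <= 4.
Proof.
  intros Hx Hy Hi Hj; unfold spin_gap; apply Rabs_le.
  destruct (coord_spins n i x Hx Hi) as [-> | ->], (coord_spins n i y Hy Hi) as [-> | ->],
    (coord_spins n j x Hx Hj) as [-> | ->], (coord_spins n j y Hy Hj) as [-> | ->]; lra.
Qed.

(** [A_n] is a quarter of the average squared gap, and a gap is at most 4 in absolute value. *)
Lemma A_n_bound (n : nat) (x y : list R) :
  (0 < n)%nat -> In x (spins n) -> In y (spins n) -> 0 <= A_n n x y <= 4.
Proof.
  intros Hn Hx Hy; pose proof (sum_spin_gap_sqr n x y Hn Hx Hy) as H.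
  apply INR_gt_0 in Hn.
  assert (Hb : forall i j, (i < n)%nat -> (j < n)%nat -> 0 <= spin_gap x y i j ^ 2 <= 16).
  { intros i j Hi Hj; pose proof (spin_gap_bound n i j x y Hx Hy Hi Hj) as K.
    apply Rabs_le_between in K; split; nra. }
  assert (H1 : sum_upto n (fun i => sum_upto n (fun j => spin_gap x y i j ^ 2))
               <= INR n * (INR n * 16)).
  { rewrite <- (sum_upto_const n (INR n * 16)); apply sum_upto_le; intros i Hi.
    rewrite <- (sum_upto_const n 16); apply sum_upto_le; intros j Hj; now apply Hb. }
  assert (H2 : INR n * (INR n * 0)
               <= sum_upto n (fun i => sum_upto n (fun j => spin_gap x y i j ^ 2))).
  { rewrite <- (sum_upto_const n (INR n * 0)); apply sum_upto_le; intros i Hi.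
    rewrite <- (sum_upto_const n 0); apply sum_upto_le; intros j Hj; now apply Hb. }
  assert (0 < INR n ^ 2) by (apply pow_lt; easy). split; nra.
Qed.

(** The sample means are unchanged, so only the sum of [x_k * y_k] moves, by minus the gap. *)
Lemma W_n_swap (n i j : nat) (x y : list R) :
  (i < n)%nat -> (j < n)%nat ->
  W_n n (swap n i j x) y = W_n n x y - spin_gap x y i j / sqrt (INR n).
Proof.
  intros Hi Hj; unfold W_n; rewrite !T_n_eq by lia.
  assert (Hn : 0 < INR n) by (apply INR_gt_0; lia).
  pose proof (sum_upto_swap n i j (fun a k => a * coord y k) x Hi Hj) as H.
  cbv beta in H; rewrite H; clear H.
  unfold sample_mean; rewrite sum_coord_swap by easy; unfold spin_gap.
  assert (Hs : INR n = sqrt (INR n) * sqrt (INR n)) by (symmetry; apply sqrt_sqrt; lra).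
  assert (Hs0 : 0 < sqrt (INR n)) by now apply sqrt_lt_R0.
  set (s := sqrt (INR n)) in *; clearbody s; rewrite Hs; field; lra.
Qed.

Definition swap_invariant (n : nat) (p : list R -> R) : Prop :=
  forall i j z, (i < n)%nat -> (j < n)%nat -> In z (spins n) -> p (swap n i j z) = p z.

(* The integrand is antisymmetric under the exchange of spins [i] and [j] of [x]. *)
Lemma exchangeable_pair_zero (n i j : nat) (p q : list R -> R) (g : R -> R) :
  swap_invariant n p -> (i < n)%nat -> (j < n)%nat ->
  expect2 n p q (fun x y => spin_gap x y i j *
     (g (W_n n x y) + g (W_n n x y - spin_gap x y i j / sqrt (INR n)))) = 0.
Proof.
  intros Hp Hi Hj; unfold expect2.
  match goal with |- ?S = 0 => assert (H : S = - S); [|lra] end.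
  rewrite <- (sum_spins_swap n i j) at 1 by easy.
  match goal with |- _ = - ?S => replace (- S) with (-1 * S) by ring end.
  rewrite <- sumR_map_scal; apply sumR_map_ext; intros x Hx.
  rewrite <- sumR_map_scal; apply sumR_map_ext; intros y Hy.
  rewrite Hp, W_n_swap by easy.
  assert (E : spin_gap (swap n i j x) y i j = - spin_gap x y i j).
  { unfold spin_gap; rewrite !coord_swap by easy; unfold transpose.
    rewrite !Nat.eqb_refl. destruct (Nat.eqb_spec j i) as [->|]; ring. }
  rewrite E.
  replace (W_n n x y - spin_gap x y i j / sqrt (INR n) - - spin_gap x y i j / sqrt (INR n))
    with (W_n n x y) by (unfold Rdiv; ring). ring.
Qed.

(** Mean value theorem for [g t - t * g' a]: a modulus of continuity of [g'] does the work of a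
    second derivative. *)
Lemma stein_remainder (g g' : R -> R) (a d eta : R) :
  (forall t, is_derive g t (g' t)) ->
  (forall t, Rabs (t - a) <= Rabs d -> Rabs (g' t - g' a) <= eta) ->
  Rabs (g (a - d) - g a + d * g' a) <= Rabs d * eta.
Proof.
  intros Hg Heta.
  destruct (MVT_gen (fun t => g t - t * g' a) a (a - d) (fun t => g' t - g' a))
    as (c & Hc & E).
  - intros t _; auto_derive; [now exists (g' t)|].
    replace (Derive (fun x => g x) t) with (g' t); [ring|].
    symmetry; apply is_derive_unique, Hg.
  - intros t _; apply derivable_continuous_pt; exists (g' t - g' a).
    apply is_derive_Reals; auto_derive; [now exists (g' t)|].
    replace (Derive (fun x => g x) t) with (g' t); [ring|].
    symmetry; apply is_derive_unique, Hg.
  - replace (g (a - d) - g a + d * g' a) with ((g' c - g' a) * (- d))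
      by (ring_simplify in E; ring_simplify; lra).
    rewrite Rabs_mult, Rabs_Ropp, Rmult_comm.
    apply Rmult_le_compat_l; [apply Rabs_pos|]; apply Heta.
    unfold Rmin, Rmax in Hc; unfold Rabs; destruct (Rle_dec a (a - d));
      destruct (Rcase_abs (c - a)), (Rcase_abs d); lra.
Qed.

(** Writing [D] for a gap and [s] for [sqrt n], expand [g (W - D / s)] in
    [D * (g W + g (W - D / s))], whose expectation is 0. This gives [2 D g(W) - (D^2 / s) g'(W)]
    plus a remainder of size at most [16 eta / s]; summing over all pairs produces [T_n] from the
    linear part and [A_n] from the quadratic part. *)
Lemma stein_identity (n : nat) (p q : list R -> R) (g g' : R -> R) (eta : R) :
  (0 < n)%nat -> pmf_on n p -> pmf_on n q -> swap_invariant n p ->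
  (forall t, is_derive g t (g' t)) ->
  (forall s t, Rabs (s - t) <= 4 / sqrt (INR n) -> Rabs (g' s - g' t) <= eta) ->
  Rabs (expect2 n p q (fun x y => W_n n x y * g (W_n n x y) - A_n n x y * g' (W_n n x y)))
  <= 4 * eta.
Proof.
  intros Hn Hp Hq Hs Hg Heta.
  pose proof (INR_gt_0 n Hn) as HN.
  set (s := sqrt (INR n)).
  assert (Hs0 : 0 < s) by now apply sqrt_lt_R0.
  assert (Hss : s * s = INR n) by (apply sqrt_sqrt; lra).
  assert (He : 0 <= eta).
  { pose proof (Heta 0 0) as H; rewrite !Rminus_diag, Rabs_R0 in H; apply H.
    apply Rlt_le, Rdiv_lt_0_compat; [lra|easy]. }
  set (D := fun x y i j => spin_gap x y i j).
  set (r := fun x y i j => g (W_n n x y - D x y i j / s) - g (W_n n x y)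
                           + D x y i j / s * g' (W_n n x y)).
  assert (Hr : forall x y i j, In x (spins n) -> In y (spins n) -> (i < n)%nat -> (j < n)%nat ->
     Rabs (D x y i j * r x y i j) <= 16 * eta / s).
  { intros x y i j Hx Hy Hi Hj; rewrite Rabs_mult.
    pose proof (spin_gap_bound n i j x y Hx Hy Hi Hj) as HD; fold (D x y i j) in HD.
    assert (Hd : Rabs (D x y i j / s) <= 4 / s).
    { unfold Rdiv; rewrite Rabs_mult, (Rabs_pos_eq (/ s)).
      - apply Rmult_le_compat_r; [|easy]. now apply Rlt_le, Rinv_0_lt_compat.
      - now apply Rlt_le, Rinv_0_lt_compat. }
    assert (K : Rabs (r x y i j) <= 4 / s * eta).
    { eapply Rle_trans; [apply (stein_remainder g g' _ _ eta Hg)|].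
      - intros t Ht; apply Heta; eapply Rle_trans; [exact Ht|exact Hd].
      - now apply Rmult_le_compat_r. }
    replace (16 * eta / s) with (4 * (4 / s * eta)) by (field; lra).
    apply Rmult_le_compat; try apply Rabs_pos; easy. }
  assert (E0 : expect2 n p q (fun x y => sum_upto n (fun i => sum_upto n (fun j =>
      D x y i j * (g (W_n n x y) + g (W_n n x y - D x y i j / s))))) = 0).
  { rewrite (expect2_sum_upto n n p q
      (fun i x y => sum_upto n (fun j =>
      D x y i j * (g (W_n n x y) + g (W_n n x y - D x y i j / s))))).
    rewrite (sum_upto_ext n _ (fun _ => 0)); [rewrite sum_upto_const; ring|].
    intros i Hi.
    rewrite (expect2_sum_upto n n p q
      (fun j x y => D x y i j * (g (W_n n x y) + g (W_n n x y - D x y i j / s)))).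
    rewrite (sum_upto_ext n _ (fun _ => 0)); [rewrite sum_upto_const; ring|].
    intros j Hj; now apply exchangeable_pair_zero. }
  set (Rem := fun x y => sum_upto n (fun i => sum_upto n (fun j => D x y i j * r x y i j))).
  assert (HRem : forall x y, In x (spins n) -> In y (spins n) ->
     Rabs (Rem x y) <= INR n * (INR n * (16 * eta / s))).
  { intros x y Hx Hy; unfold Rem.
    eapply Rle_trans; [apply sum_upto_Rabs|].
    rewrite <- (sum_upto_const n (INR n * (16 * eta / s))); apply sum_upto_le; intros i Hi.
    eapply Rle_trans; [apply sum_upto_Rabs|].
    rewrite <- (sum_upto_const n (16 * eta / s)); apply sum_upto_le; intros j Hj; auto. }
  (* The factor [1 / (4 n s)] turns [4 n^2 T_n] into [W], since [s^2 = n]. The remainder, at most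
     [16 n^2 eta / s], becomes [4 eta]. *)
  rewrite (expect2_ext n p q _ (fun x y => / (4 * INR n * s) *
     (sum_upto n (fun i => sum_upto n (fun j =>
      D x y i j * (g (W_n n x y) + g (W_n n x y - D x y i j / s)))) + -1 * Rem x y))).
  - rewrite expect2_scal, expect2_plus, E0, expect2_scal, Rplus_0_l, !Rabs_mult.
    rewrite (Rabs_left (-1)) by lra.
    assert (HE : Rabs (expect2 n p q Rem) <= INR n * (INR n * (16 * eta / s))).
    { eapply Rle_trans; [apply (expect2_Rabs_le n p q _ (fun _ _ => INR n * (INR n * (16 * eta / s))))|];
        try easy. rewrite expect2_const by easy; lra. }
    assert (Hc : 0 < / (4 * INR n * s)) by (apply Rinv_0_lt_compat; nra).
    rewrite (Rabs_pos_eq (/ _)) by lra.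
    replace (4 * eta) with (/ (4 * INR n * s) * (INR n * (INR n * (16 * eta / s)))).
    + apply Rmult_le_compat_l; lra.
    + rewrite <- Hss; field; lra.
  - intros x y Hx Hy.
    assert (E : sum_upto n (fun i => sum_upto n (fun j =>
      D x y i j * (g (W_n n x y) + g (W_n n x y - D x y i j / s))))
      = 2 * g (W_n n x y) * (2 * INR n ^ 2 * T_n n x y)
        + (- g' (W_n n x y) / s) * (4 * INR n ^ 2 * A_n n x y) + Rem x y).
    { rewrite <- sum_spin_gap, <- sum_spin_gap_sqr by easy.
      unfold Rem; rewrite <- !sum_upto_scal, <- !sum_upto_plus.
      apply sum_upto_ext; intros i _.
      rewrite <- !sum_upto_scal, <- !sum_upto_plus.
      apply sum_upto_ext; intros j _; unfold r; fold (D x y i j). field; lra. }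
    rewrite E; unfold W_n at 1; fold s; rewrite <- Hss; field; lra.
Qed.

(** Stein's identity for the identity function is exact, as its derivative is constant:
    [E W^2 = E A_n]. *)
Lemma expect2_W_sqr_le (n : nat) (p q : list R -> R) :
  (0 < n)%nat -> pmf_on n p -> pmf_on n q -> swap_invariant n p ->
  expect2 n p q (fun x y => W_n n x y ^ 2) <= 4.
Proof.
  intros Hn Hp Hq Hs.
  pose proof (stein_identity n p q (fun t => t) (fun _ => 1) 0 Hn Hp Hq Hs) as H.
  rewrite (expect2_ext n p q _ (fun x y => W_n n x y ^ 2 + -1 * A_n n x y)) in H
    by (intros; ring).
  rewrite expect2_plus, expect2_scal in H.
  assert (HA : expect2 n p q (A_n n) <= 4).
  { rewrite <- (expect2_const n p q 4) by easy; apply expect2_le; try easy.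
    intros; now apply A_n_bound. }
  assert (K : Rabs (expect2 n p q (fun x y => W_n n x y ^ 2) + -1 * expect2 n p q (A_n n)) <= 4 * 0).
  { apply H; [intros t; apply (is_derive_id (K := R_AbsRing))|].
    intros; rewrite Rminus_diag, Rabs_R0; lra. }
  apply Rabs_le_between in K; lra.
Qed.

Lemma sample_mean_bound (n : nat) (z : list R) :
  (0 < n)%nat -> In z (spins n) -> -1 <= sample_mean n z <= 1.
Proof.
  intros Hn Hz; assert (HN := INR_gt_0 n Hn); unfold sample_mean.
  assert (H1 : sum_upto n (coord z) <= INR n * 1).
  { rewrite <- (sum_upto_const n 1); apply sum_upto_le; intros i Hi.
    destruct (coord_spins n i z Hz Hi) as [-> | ->]; lra. }
  assert (H2 : INR n * -1 <= sum_upto n (coord z)).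
  { rewrite <- (sum_upto_const n (-1)); apply sum_upto_le; intros i Hi.
    destruct (coord_spins n i z Hz Hi) as [-> | ->]; lra. }
  split; [apply Rle_div_r|apply Rle_div_l]; lra.
Qed.

(** The squares of the sample mean and of [m] are compared, because for [beta > 1] the magnetization
    concentrates near [m] and [-m] with equal weight. *)
Definition mean_sqr_dev (n : nat) (m : R) (p : list R -> R) : R :=
  sumR (map (fun x => p x * Rabs (sample_mean n x ^ 2 - m ^ 2)) (spins n)).

(** [A_n - v] is a combination of [Xbar^2 - m1^2] and [Ybar^2 - m2^2] with coefficients at most 1 in
    absolute value, plus terms in [T_n = W / sqrt n]. The latter cost
    [(1/n + 1/sqrt n) E W^2 + 1/sqrt n], and [E W^2 <= 4] gives the constants 4 and 5. *)
Lemma expect2_A_dev (n : nat) (p q : list R -> R) (m1 m2 : R) :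
  (0 < n)%nat -> pmf_on n p -> pmf_on n q -> swap_invariant n p -> 0 <= m1 ^ 2 <= 1 ->
  expect2 n p q (fun x y => Rabs (A_n n x y - (1 - m1 ^ 2) * (1 - m2 ^ 2)))
  <= mean_sqr_dev n m1 p + mean_sqr_dev n m2 q + 4 / INR n + 5 / sqrt (INR n).
Proof.
  intros Hn Hp Hq Hs Hm.
  assert (HN := INR_gt_0 n Hn).
  set (s := sqrt (INR n)).
  assert (Hs0 : 0 < s) by now apply sqrt_lt_R0.
  assert (Hss : s * s = INR n) by (apply sqrt_sqrt; lra).
  assert (His : 0 < / s) by now apply Rinv_0_lt_compat.
  assert (HW := expect2_W_sqr_le n p q Hn Hp Hq Hs).
  eapply Rle_trans.
  - apply (expect2_le n p q _ (fun x y =>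
      (Rabs (sample_mean n x ^ 2 - m1 ^ 2) + Rabs (sample_mean n y ^ 2 - m2 ^ 2))
      + ((/ INR n + / s) * W_n n x y ^ 2 + / s))); try easy.
    intros x y Hx Hy.
    pose proof (sample_mean_bound n x Hn Hx) as BX.
    pose proof (sample_mean_bound n y Hn Hy) as BY.
    unfold A_n; set (X := sample_mean n x) in *; set (Y := sample_mean n y) in *.
    set (T := T_n n x y).
    assert (HT : W_n n x y = s * T) by easy. rewrite HT.
    replace (1 - X ^ 2 - Y ^ 2 + (T + X * Y) ^ 2 - (1 - m1 ^ 2) * (1 - m2 ^ 2))
      with (- (1 - Y ^ 2) * (X ^ 2 - m1 ^ 2) + - (1 - m1 ^ 2) * (Y ^ 2 - m2 ^ 2)
            + (T ^ 2 + 2 * T * (X * Y))) by ring.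
    assert (B1 : Rabs (- (1 - Y ^ 2) * (X ^ 2 - m1 ^ 2)) <= Rabs (X ^ 2 - m1 ^ 2)).
    { rewrite Rabs_mult. rewrite <- (Rmult_1_l (Rabs (X ^ 2 - m1 ^ 2))) at 2.
      apply Rmult_le_compat_r; [apply Rabs_pos|apply Rabs_le; nra]. }
    assert (B2 : Rabs (- (1 - m1 ^ 2) * (Y ^ 2 - m2 ^ 2)) <= Rabs (Y ^ 2 - m2 ^ 2)).
    { rewrite Rabs_mult. rewrite <- (Rmult_1_l (Rabs (Y ^ 2 - m2 ^ 2))) at 2.
      apply Rmult_le_compat_r; [apply Rabs_pos|apply Rabs_le; lra]. }
    assert (B3 : Rabs (T ^ 2 + 2 * T * (X * Y)) <= (/ INR n + / s) * (s * T) ^ 2 + / s).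
    { replace ((/ INR n + / s) * (s * T) ^ 2 + / s) with (T ^ 2 + / s * ((s * T) ^ 2 + 1))
        by (rewrite <- Hss; field; lra).
      (* This is [2 u <= u^2 + 1] at [u = s * |T|]; it bounds the linear term through the second
         moment of [W]. *)
      assert (C : 2 * Rabs T <= / s * ((s * T) ^ 2 + 1)).
      { replace (2 * Rabs T) with (/ s * (2 * (s * Rabs T))) by (field; lra).
        apply Rmult_le_compat_l; [lra|].
        rewrite <- (pow2_abs (s * T)), Rabs_mult, (Rabs_pos_eq s) by lra.
        pose proof (pow2_ge_0 (s * Rabs T - 1)); lra. }
      eapply Rle_trans; [apply Rabs_triang|].
      rewrite (Rabs_pos_eq (T ^ 2)) by apply pow2_ge_0.
      apply Rplus_le_compat_l. rewrite Rabs_mult, Rabs_mult, (Rabs_pos_eq 2) by lra.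
      assert (Rabs (X * Y) <= 1) by (apply Rabs_le; nra).
      pose proof (Rabs_pos T). nra. }
    eapply Rle_trans; [apply Rabs_triang|]; apply Rplus_le_compat; [|easy].
    eapply Rle_trans; [apply Rabs_triang|]; lra.
  - rewrite !expect2_plus, expect2_scal, (expect2_const n p q (/ s)) by easy.
    rewrite (expect2_fst n p q (fun x => Rabs (sample_mean n x ^ 2 - m1 ^ 2))) by easy.
    rewrite (expect2_snd n p q (fun y => Rabs (sample_mean n y ^ 2 - m2 ^ 2))) by easy.
    fold (mean_sqr_dev n m1 p) (mean_sqr_dev n m2 q).
    assert (0 < / INR n) by now apply Rinv_0_lt_compat.
    unfold Rdiv; nra.
Qed.

(** * Concentration of the Curie-Weiss magnetization *)

(** With a single exponential, monotonicity and the bound by 1 can be read off. *)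
Lemma tanh_exp_eq (u : R) : Defs.tanh u = 1 - 2 / (exp (2 * u) + 1).
Proof.
  unfold Defs.tanh; replace (2 * u) with (u + u) by ring.
  rewrite exp_plus, exp_Ropp. pose proof (exp_pos u).
  field; split; nra.
Qed.

Lemma tanh_increasing (s t : R) : s < t -> Defs.tanh s < Defs.tanh t.
Proof.
  intros H; rewrite !tanh_exp_eq.
  assert (exp (2 * s) < exp (2 * t)) by (apply exp_increasing; lra).
  pose proof (exp_pos (2 * s)); pose proof (exp_pos (2 * t)).
  assert (2 / (exp (2 * t) + 1) < 2 / (exp (2 * s) + 1)); [|lra].
  apply Rmult_lt_compat_l; [lra|]; apply Rinv_lt_contravar; [apply Rmult_lt_0_compat|]; lra.
Qed.

Lemma tanh_0 : Defs.tanh 0 = 0.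
Proof. unfold Defs.tanh; rewrite Ropp_0, exp_0; field. Qed.

Lemma tanh_lt_1 (u : R) : Defs.tanh u < 1.
Proof.
  rewrite tanh_exp_eq; pose proof (exp_pos (2 * u)).
  assert (0 < 2 / (exp (2 * u) + 1)) by (apply Rdiv_lt_0_compat; lra). lra.
Qed.

Lemma tanh_pos (u : R) : 0 < u -> 0 < Defs.tanh u.
Proof. intros H; rewrite <- tanh_0; now apply tanh_increasing. Qed.

Lemma tanh_derivable (u : R) : derivable_pt_lim Defs.tanh u (1 - Defs.tanh u ^ 2).
Proof.
  apply is_derive_Reals; unfold Defs.tanh.
  pose proof (exp_pos u); pose proof (exp_pos (- u)).
  auto_derive; [lra|field; lra].
Qed.

Lemma tanh_lt_id (u : R) : 0 < u -> Defs.tanh u < u.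
Proof.
  intros Hu.
  destruct (MVT_cor2 Defs.tanh (fun c => 1 - Defs.tanh c ^ 2) 0 u Hu) as (c & E & Hc).
  - intros; apply tanh_derivable.
  - rewrite tanh_0 in E; pose proof (tanh_pos c (proj1 Hc)).
    assert (0 < Defs.tanh c ^ 2) by now apply pow_lt. nra.
Qed.

(** In other words [tanh u / u] decreases: the derivative [1 - tanh^2] decreases, so the mean slope
    on [[0, s]] exceeds the one on [[s, t]]. This locates [tanh (beta t)] relative to [t] on either
    side of the fixed point [m]. *)
Lemma tanh_star_shaped (s t : R) :
  0 < s -> s < t -> s * Defs.tanh t < t * Defs.tanh s.
Proof.
  intros Hs Hst.
  destruct (MVT_cor2 Defs.tanh (fun c => 1 - Defs.tanh c ^ 2) 0 s Hs) as (c & E & Hc).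
  { intros; apply tanh_derivable. }
  destruct (MVT_cor2 Defs.tanh (fun c => 1 - Defs.tanh c ^ 2) s t Hst) as (d & F & Hd).
  { intros; apply tanh_derivable. }
  rewrite tanh_0 in E.
  pose proof (tanh_pos c (proj1 Hc)).
  assert (Defs.tanh c < Defs.tanh d) by (apply tanh_increasing; lra).
  assert (Defs.tanh c ^ 2 < Defs.tanh d ^ 2) by nra.
  assert (0 < s * (t - s)) by (apply Rmult_lt_0_compat; lra).
  nra.
Qed.

Lemma cw_magnetization_range (beta m : R) : cw_magnetization beta m -> 0 <= m < 1.
Proof.
  intros [H1 H2]; destruct (Rle_lt_dec beta 1) as [H|H].
  - rewrite (H1 H); lra.
  - destruct (H2 H) as [H3 H4]; split; [lra|rewrite H4; apply tanh_lt_1].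
Qed.

(* [ln (cw_rate b t)] is the free energy per spin of the Curie-Weiss model at
   magnetization [t]. *)
Definition cw_rate (b t : R) : R := exp (- (b * t ^ 2 / 2)) * (exp (b * t) + exp (- (b * t))).

Lemma cw_rate_pos (b t : R) : 0 < cw_rate b t.
Proof.
  unfold cw_rate; pose proof (exp_pos (b * t)); pose proof (exp_pos (- (b * t))).
  apply Rmult_lt_0_compat; [apply exp_pos|lra].
Qed.

Lemma cw_rate_Rabs (b t : R) : cw_rate b (Rabs t) = cw_rate b t.
Proof.
  unfold Rabs; destruct (Rcase_abs t); [|easy].
  unfold cw_rate; replace ((- t) ^ 2) with (t ^ 2) by ring.
  replace (b * - t) with (- (b * t)) by ring; rewrite Ropp_involutive; ring.
Qed.

Lemma cw_rate_derivable (b t : R) :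
  derivable_pt_lim (cw_rate b) t (b * cw_rate b t * (Defs.tanh (b * t) - t)).
Proof.
  apply is_derive_Reals; unfold cw_rate, Defs.tanh.
  pose proof (exp_pos (b * t)); pose proof (exp_pos (- (b * t))).
  auto_derive; [easy|].
  replace (- (b * (t * (t * 1)) * / 2)) with (- (b * t ^ 2 / 2)) by (simpl; field).
  field; lra.
Qed.

(** By [cw_rate_derivable] these inequalities are the signs of the derivative of [cw_rate b], so on
    the nonnegative half-line its strict maximum is at [m]. *)
Definition cw_peak (b m : R) : Prop :=
  0 < b /\ 0 <= m /\ (forall t, 0 < t < m -> t < Defs.tanh (b * t))
  /\ (forall t, m < t -> Defs.tanh (b * t) < t).

(** At or below criticality [m = 0] and the claim at 1 is [tanh t < t]. Above it,
    [tanh (beta t) / (beta t)] is compared with its value [1 / beta] at [t = m]. *)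
Lemma cw_magnetization_peak (beta m : R) :
  cw_magnetization beta m -> cw_peak (Rmax beta 1) m.
Proof.
  intros H; pose proof (cw_magnetization_range beta m H) as Hm; destruct H as [H1 H2].
  unfold Rmax; destruct (Rle_dec beta 1) as [H|H].
  - rewrite (H1 H); split; [lra|]; split; [lra|]; split; [intros; lra|].
    intros t Ht; rewrite Rmult_1_l; now apply tanh_lt_id.
  - assert (Hb : 1 < beta) by lra; destruct (H2 Hb) as [Hp He].
    split; [lra|]; split; [lra|]; split; intros t Ht.
    + pose proof (tanh_star_shaped (beta * t) (beta * m)) as K.
      rewrite <- He in K.
      assert (beta * t * m < beta * m * Defs.tanh (beta * t)) by (apply K; nra).
      assert (0 < beta * m) by nra.
      apply (Rmult_lt_reg_l (beta * m)); lra.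
    + pose proof (tanh_star_shaped (beta * m) (beta * t)) as K.
      rewrite <- He in K.
      assert (beta * m * Defs.tanh (beta * t) < beta * t * m) by (apply K; nra).
      assert (0 < beta * m) by nra.
      apply (Rmult_lt_reg_l (beta * m)); lra.
Qed.

Lemma cw_rate_increasing (b m s t : R) :
  cw_peak b m -> 0 <= s -> s < t -> t <= m -> cw_rate b s < cw_rate b t.
Proof.
  intros (Hb & Hm & H1 & _) Hs Hst Htm.
  destruct (MVT_cor2 (cw_rate b) _ s t Hst (fun c _ => cw_rate_derivable b c)) as (c & E & Hc).
  pose proof (cw_rate_pos b c). assert (c < Defs.tanh (b * c)) by (apply H1; lra).
  assert (0 < b * cw_rate b c * (Defs.tanh (b * c) - c) * (t - s)); [|lra].
  do 2 (apply Rmult_lt_0_compat; [|lra]); apply Rmult_lt_0_compat; lra.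
Qed.

Lemma cw_rate_decreasing (b m s t : R) :
  cw_peak b m -> m <= s -> s < t -> cw_rate b t < cw_rate b s.
Proof.
  intros (Hb & Hm & _ & H2) Hs Hst.
  destruct (MVT_cor2 (cw_rate b) _ s t Hst (fun c _ => cw_rate_derivable b c)) as (c & E & Hc).
  pose proof (cw_rate_pos b c). assert (Defs.tanh (b * c) < c) by (apply H2; lra).
  assert (0 < b * cw_rate b c * (c - Defs.tanh (b * c)) * (t - s)); [|lra].
  do 2 (apply Rmult_lt_0_compat; [|lra]); apply Rmult_lt_0_compat; lra.
Qed.

Lemma pow2_lt_reg (x y : R) : 0 <= y -> x ^ 2 < y ^ 2 -> x < y.
Proof.
  intros Hy H; apply Rnot_le_lt; intros K.
  assert (y ^ 2 <= x ^ 2) by now apply pow_incr. lra.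
Qed.

(** Since [cw_rate b] is even and monotone on each side of [m], its supremum outside the band is
    attained at one of the band edges [sqrt (m^2 + eps)] and [sqrt (m^2 - eps)]. *)
Lemma cw_rate_gap (b m eps : R) : cw_peak b m -> 0 < eps ->
  exists rho, 0 < rho < 1 /\
    forall x, eps < Rabs (x ^ 2 - m ^ 2) -> cw_rate b x <= rho * cw_rate b m.
Proof.
  intros Hpk He; pose proof Hpk as (Hb & Hm & _).
  pose proof (cw_rate_pos b m) as Pm.
  set (a := sqrt (m ^ 2 + eps)).
  assert (Ha0 : 0 <= a) by apply sqrt_pos.
  assert (Ha2 : a ^ 2 = m ^ 2 + eps) by (apply pow2_sqrt; pose proof (pow2_ge_0 m); lra).
  assert (Ha : m < a) by (apply pow2_lt_reg; lra).
  pose proof (cw_rate_decreasing b m m a Hpk (Rle_refl m) Ha) as Ga.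
  assert (Far : forall x, m ^ 2 + eps < x ^ 2 -> cw_rate b x < cw_rate b a).
  { intros x Hx; rewrite <- cw_rate_Rabs; apply (cw_rate_decreasing b m); [easy|lra|].
    rewrite <- (pow2_abs x), <- Ha2 in Hx; apply pow2_lt_reg; [apply Rabs_pos|easy]. }
  assert (Near : exists r, 0 < r < cw_rate b m /\
     forall x, x ^ 2 < m ^ 2 - eps -> cw_rate b x <= r).
  (* If [m^2 <= eps] there is no [x] below the band, and [cw_rate b a] merely fills the place of
     [r]. *)
  { destruct (Rle_lt_dec (m ^ 2) eps) as [H|H].
    - exists (cw_rate b a); split; [split; [apply cw_rate_pos|easy]|].
      intros x Hx; pose proof (pow2_ge_0 x); lra.
    - set (c := sqrt (m ^ 2 - eps)).
      assert (Hc0 : 0 <= c) by apply sqrt_pos.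
      assert (Hc2 : c ^ 2 = m ^ 2 - eps) by (apply pow2_sqrt; lra).
      assert (Hc : c < m) by (apply pow2_lt_reg; lra).
      exists (cw_rate b c); split; [split; [apply cw_rate_pos|]|].
      + apply (cw_rate_increasing b m); lra || easy.
      + intros x Hx; rewrite <- cw_rate_Rabs; apply Rlt_le.
        rewrite <- (pow2_abs x), <- Hc2 in Hx.
        apply pow2_lt_reg in Hx; [|easy].
        apply (cw_rate_increasing b m); [easy|apply Rabs_pos|easy|lra]. }
  destruct Near as (r & Hr & Near).
  set (M := Rmax r (cw_rate b a)).
  assert (HM : r <= M /\ cw_rate b a <= M) by (split; [apply Rmax_l|apply Rmax_r]).
  assert (HM2 : M < cw_rate b m) by (apply Rmax_lub_lt; lra).
  exists (M / cw_rate b m); split; [split|].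
  - apply Rdiv_lt_0_compat; lra.
  - apply Rlt_div_l; lra.
  - intros x Hx; replace (M / cw_rate b m * cw_rate b m) with M by (field; lra).
    unfold Rabs in Hx; destruct (Rcase_abs (x ^ 2 - m ^ 2)).
    + pose proof (Near x); lra.
    + pose proof (Far x); lra.
Qed.

(** * Curie-Weiss weights and the Chernoff bound *)

Lemma quad_form_CW (n : nat) (z : list R) : (0 < n)%nat -> In z (spins n) ->
  quad_form n (Q_CW n) z = INR n * sample_mean n z ^ 2 - 1.
Proof.
  intros Hn Hz; assert (HN := INR_gt_0 n Hn); unfold quad_form.
  set (S := sum_upto n (coord z)).
  rewrite (sum_upto_ext n _ (fun i => (1 / INR n * S) * coord z i + - (1 / INR n))).
  - rewrite sum_upto_plus, sum_upto_scal, sum_upto_const.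
    change (fun i => coord z i) with (coord z).
    unfold sample_mean; fold S; field; lra.
  - intros i Hi.
    (* The zero diagonal is a full row with one entry overwritten. The lost entry is
       [x_i^2 / n = 1 / n], and over all rows this makes the [- 1]. *)
    rewrite (sum_upto_ext n _ (fun j => if Nat.eqb j i then 0
      else 1 / INR n * coord z i * coord z j)).
    + rewrite sum_upto_update, sum_upto_scal by easy.
      change (fun i => coord z i) with (coord z); fold S.
      pose proof (coord_spins_sqr n i z Hz Hi) as E.
      replace (1 / INR n * coord z i * coord z i)
        with (1 / INR n * (coord z i * coord z i)) by ring. rewrite E; ring.
    + intros j _; unfold Q_CW; rewrite Nat.eqb_sym; destruct (Nat.eqb j i); ring.
Qed.

Lemma sum_spins_exp (n : nat) (theta : R) :
  sumR (map (fun z => exp (theta * sum_upto n (coord z))) (spins n))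
  = (exp theta + exp (- theta)) ^ n.
Proof.
  induction n as [|n IH]; [simpl; rewrite Rmult_0_r, exp_0; ring|].
  change (spins (S n)) with (map (cons 1) (spins n) ++ map (cons (-1)) (spins n)).
  rewrite map_app, sumR_app, !map_map.
  rewrite (sumR_map_ext _ _ (fun z => exp theta * exp (theta * sum_upto n (coord z))))
    by (intros z _; rewrite sum_upto_cons, <- exp_plus; f_equal; ring).
  rewrite (sumR_map_ext _ (fun z => exp (theta * sum_upto (S n) (coord (-1 :: z))))
    (fun z => exp (- theta) * exp (theta * sum_upto n (coord z))))
    by (intros z _; rewrite sum_upto_cons, <- exp_plus; f_equal; ring).
  rewrite !sumR_map_scal, IH; simpl; ring.
Qed.

(** [k] is the number of spins equal to 1. It indexes the union bound in [cw_mean_sqr_dev_le]. *)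
Lemma sum_coord_parity (n : nat) (z : list R) : In z (spins n) ->
  exists k, (k < S n)%nat /\ sum_upto n (coord z) = 2 * INR k - INR n.
Proof.
  revert z; induction n as [|n IH]; intros z Hz.
  - exists 0%nat; split; [lia|simpl; ring].
  - simpl in Hz; apply in_app_iff in Hz.
    destruct Hz as [Hz|Hz]; apply in_map_iff in Hz as (w & <- & Hw);
      destruct (IH w Hw) as (k & Hk & E); rewrite sum_upto_cons, E, S_INR.
    + exists (S k); split; [lia|rewrite S_INR; ring].
    + exists k; split; [lia|ring].
Qed.

Lemma exp_pow_INR (n : nat) (x : R) : exp x ^ n = exp (INR n * x).
Proof.
  induction n as [|n IH]; [simpl; rewrite Rmult_0_l, exp_0; easy|].
  rewrite S_INR; simpl; rewrite IH, <- exp_plus; f_equal; ring.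
Qed.

Lemma exp_le_compat (x y : R) : x <= y -> exp x <= exp y.
Proof. intros [H| ->]; [now apply Rlt_le, exp_increasing|lra]. Qed.

(** As a function of the spin sum [S], the exponent [b x S - n b x^2 / 2] is the tangent at
    [S = n x] to the Curie-Weiss exponent [b S^2 / (2 n)]. Being affine in [S], it makes the sum
    factorize over spins. *)
Lemma sum_spins_exp_tilt (n : nat) (b x c : R) :
  sumR (map (fun z => exp (b * x * sum_upto n (coord z) - INR n * b * x ^ 2 / 2 + c)) (spins n))
  = exp c * cw_rate b x ^ n.
Proof.
  rewrite (sumR_map_ext _ _ (fun z => (exp c * exp (- (b * x ^ 2 / 2)) ^ n)
     * exp (b * x * sum_upto n (coord z)))).
  - rewrite sumR_map_scal, sum_spins_exp; unfold cw_rate; rewrite Rpow_mult_distr; ring.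
  - intros z _; rewrite exp_pow_INR, <- !exp_plus; f_equal; field.
Qed.

Lemma ising_weight_CW (n : nat) (beta : R) (z : list R) : (0 < n)%nat -> In z (spins n) ->
  ising_weight n beta (Q_CW n) z
  = exp (beta * INR n * sample_mean n z ^ 2 / 2 - beta / 2).
Proof.
  intros Hn Hz; unfold ising_weight; rewrite quad_form_CW by easy; f_equal; field.
Qed.

Lemma sum_coord_mean (n : nat) (z : list R) : (0 < n)%nat ->
  sum_upto n (coord z) = INR n * sample_mean n z.
Proof. intros Hn; apply INR_gt_0 in Hn; unfold sample_mean; field; lra. Qed.

(* [S^2 / n >= 2 m S - n m^2] bounds the weight below by a product weight. *)
Lemma partition_fn_CW_ge (n : nat) (beta m : R) : (0 < n)%nat -> 0 <= beta ->
  exp (- beta / 2) * cw_rate beta m ^ n <= partition_fn n beta (Q_CW n).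
Proof.
  intros Hn Hb; rewrite <- sum_spins_exp_tilt; apply sumR_map_le; intros z Hz.
  rewrite ising_weight_CW, sum_coord_mean by easy; apply INR_gt_0 in Hn.
  apply exp_le_compat. set (X := sample_mean n z).
  assert (0 <= beta * INR n * (X - m) ^ 2).
  { apply Rmult_le_pos; [nra|apply pow2_ge_0]. } nra.
Qed.

Lemma partition_fn_CW_pos (n : nat) (beta : R) : (0 < n)%nat -> 0 <= beta ->
  0 < partition_fn n beta (Q_CW n).
Proof.
  intros Hn Hb; eapply Rlt_le_trans; [|apply (partition_fn_CW_ge n beta 0); easy].
  apply Rmult_lt_0_compat; [apply exp_pos|apply pow_lt, cw_rate_pos].
Qed.

Lemma ising_pmf_CW (n : nat) (beta : R) : (0 < n)%nat -> 0 <= beta ->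
  pmf_on n (ising_pmf n beta (Q_CW n)).
Proof.
  intros Hn Hb; pose proof (partition_fn_CW_pos n beta Hn Hb) as HZ.
  split; unfold ising_pmf.
  - intros z _; apply Rlt_le, Rdiv_lt_0_compat; [apply exp_pos|easy].
  - rewrite (sumR_map_ext _ _ (fun z => / partition_fn n beta (Q_CW n)
      * ising_weight n beta (Q_CW n) z)) by (intros; unfold Rdiv; ring).
    rewrite sumR_map_scal. apply Rinv_l. apply Rgt_not_eq, HZ.
Qed.

Lemma ising_pmf_CW_swap (n : nat) (beta : R) :
  swap_invariant n (ising_pmf n beta (Q_CW n)).
Proof.
  intros i j z Hi Hj Hz; unfold ising_pmf.
  rewrite !ising_weight_CW by (try apply swap_in_spins; lia || easy).
  unfold sample_mean; rewrite sum_coord_swap by easy; easy.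
Qed.

(** Configurations in the band contribute at most [eps]. Each of the [n + 1] levels outside it
    contributes at most [rho^n]: the tilted sum there is at most
    [exp (- beta / 2) * (rho * cw_rate b m)^n], and [partition_fn_CW_ge] bounds [Z] below by the
    same quantity without [rho]. The hypothesis [cw_rate b m = cw_rate beta m] links the tilt at [b]
    to the partition function at [beta]. *)
Lemma cw_mean_sqr_dev_le (n : nat) (beta b m eps rho : R) :
  (0 < n)%nat -> 0 <= beta -> beta <= b -> 0 <= m < 1 -> cw_rate b m = cw_rate beta m ->
  0 < eps -> 0 < rho ->
  (forall x, eps < Rabs (x ^ 2 - m ^ 2) -> cw_rate b x <= rho * cw_rate b m) ->
  mean_sqr_dev n m (ising_pmf n beta (Q_CW n)) <= eps + INR (S n) * rho ^ n.
Proof.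
  intros Hn Hb0 Hb Hm Hbm He Hr Hgap.
  pose proof (partition_fn_CW_pos n beta Hn Hb0) as HZ.
  pose proof (partition_fn_CW_ge n beta m Hn Hb0) as HZm.
  set (Z := partition_fn n beta (Q_CW n)) in *.
  assert (HN := INR_gt_0 n Hn).
  set (lev := fun k : nat => (2 * INR k - INR n) / INR n).
  (* At the level [k] of [z] the tilted weight equals the Ising weight, and its sum over all
     spins factorizes. *)
  set (tilt := fun k z => if Rlt_dec eps (Rabs (lev k ^ 2 - m ^ 2)) then
     exp (b * lev k * sum_upto n (coord z) - INR n * b * lev k ^ 2 / 2
          + (INR n * (beta - b) * lev k ^ 2 / 2 - beta / 2)) else 0).
  assert (Htilt0 : forall k z, 0 <= tilt k z).
  { intros k z; unfold tilt; destruct Rlt_dec; [apply Rlt_le, exp_pos|lra]. }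
  assert (Hsum : sumR (map (fun z => ising_weight n beta (Q_CW n) z
     * Rabs (sample_mean n z ^ 2 - m ^ 2)) (spins n)) <= eps * Z + INR (S n) * (rho ^ n * Z)).
  { eapply Rle_trans.
    - apply (sumR_map_le _ _ (fun z => eps * ising_weight n beta (Q_CW n) z
        + sum_upto (S n) (fun k => tilt k z))); intros z Hz.
      rewrite ising_weight_CW by easy.
      destruct (sum_coord_parity n z Hz) as (k & Hk & E).
      assert (EX : sample_mean n z = lev k) by (unfold sample_mean, lev; now rewrite E).
      pose proof (sum_upto_ge_term (S n) k (fun k => tilt k z) (fun i _ => Htilt0 i z) Hk) as G.
      cbv beta in G.
      pose proof (exp_pos (beta * INR n * sample_mean n z ^ 2 / 2 - beta / 2)) as Pw.
      unfold tilt in G at 1; rewrite <- EX in G; destruct Rlt_dec as [L|L].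
      + rewrite sum_coord_mean in G by easy.
        replace (b * sample_mean n z * (INR n * sample_mean n z) -
          INR n * b * sample_mean n z ^ 2 / 2 +
          (INR n * (beta - b) * sample_mean n z ^ 2 / 2 - beta / 2))
          with (beta * INR n * sample_mean n z ^ 2 / 2 - beta / 2) in G by field.
        (* Both squares lie in [[0, 1]], so the deviation is at most 1 and the weight alone
           dominates the summand. *)
        pose proof (sample_mean_bound n z Hn Hz).
        assert (Rabs (sample_mean n z ^ 2 - m ^ 2) <= 1) by (apply Rabs_le; nra).
        nra.
      + apply Rnot_lt_le in L. nra.
    - rewrite sumR_map_plus, sumR_map_scal.
      change (sumR (map (ising_weight n beta (Q_CW n)) (spins n))) with Z.
      change (sumR (map (fun z => ising_weight n beta (Q_CW n) z) (spins n))) with Z.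
      apply Rplus_le_compat_l.
      rewrite (sumR_map_sum_upto (spins n) (S n) tilt).
      rewrite <- sum_upto_const; apply sum_upto_le; intros k _.
      unfold tilt; destruct Rlt_dec as [L|L].
      + rewrite sum_spins_exp_tilt.
        apply Rle_trans with (exp (- beta / 2) * (rho ^ n * cw_rate beta m ^ n)).
        * rewrite <- Hbm, <- Rpow_mult_distr.
          apply Rmult_le_compat; [apply Rlt_le, exp_pos|apply pow_le, Rlt_le, cw_rate_pos| |].
          (* Since [beta <= b], the correction from inverse temperature [b] back to [beta] only
             decreases the exponent. *)
          -- apply exp_le_compat. assert (0 <= INR n * (b - beta) * lev k ^ 2).
             { apply Rmult_le_pos; [nra|apply pow2_ge_0]. } nra.
          -- apply pow_incr; split; [apply Rlt_le, cw_rate_pos|]. now apply Hgap.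
        * pose proof (pow_lt rho n Hr). nra.
      + assert (Z0 : sumR (map (fun _ : list R => 0) (spins n)) = 0).
        { rewrite (sumR_map_ext _ _ (fun _ => 0 * 0)) by (intros; ring).
          rewrite (sumR_map_scal _ 0); ring. }
        rewrite Z0; apply Rmult_le_pos; [apply pow_le|]; lra. }
  unfold mean_sqr_dev, ising_pmf; fold Z.
  rewrite (sumR_map_ext _ _ (fun z => / Z * (ising_weight n beta (Q_CW n) z
     * Rabs (sample_mean n z ^ 2 - m ^ 2)))) by (intros; unfold Rdiv; ring).
  rewrite sumR_map_scal.
  replace (eps + INR (S n) * rho ^ n) with (/ Z * (eps * Z + INR (S n) * (rho ^ n * Z)))
    by (field; lra).
  apply Rmult_le_compat_l; [|easy]. now apply Rlt_le, Rinv_0_lt_compat.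
Qed.

(** Split [rho^n = s^n * s^n]. By Bernoulli's inequality ([poly]) for [1 / s = 1 + h], one factor
    absorbs [n + 1 <= (1 + 1/h) (1 + n h)], and the other tends to 0. *)
Lemma is_lim_seq_linear_geom (rho : R) : 0 < rho < 1 ->
  is_lim_seq (fun n => INR (S n) * rho ^ n) 0.
Proof.
  intros Hr; set (s := sqrt rho).
  assert (Hs0 : 0 < s) by (apply sqrt_lt_R0; lra).
  assert (Hss : s * s = rho) by (apply sqrt_sqrt; lra).
  assert (Hs1 : s < 1) by nra.
  set (h := / s - 1).
  assert (Hh : 0 < h).
  { unfold h; assert (1 < / s); [|lra]. rewrite <- Rinv_1; apply Rinv_lt_contravar; lra. }
  apply (is_lim_seq_le_le (fun _ => 0) _ (fun n => (1 + / h) * s ^ n)).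
  - intros n; split.
    + apply Rmult_le_pos; [apply pos_INR|apply pow_le; lra].
    + pose proof (poly n h Hh) as P. replace (1 + h) with (/ s) in P by (unfold h; ring).
      rewrite <- Hss, Rpow_mult_distr, <- Rmult_assoc.
      apply Rmult_le_compat_r; [apply pow_le; lra|].
      assert (Hi : 0 < / h) by now apply Rinv_0_lt_compat.
      assert (Q : INR (S n) <= (1 + / h) * (/ s) ^ n).
      { rewrite S_INR. apply Rle_trans with ((1 + / h) * (1 + INR n * h)).
        - replace ((1 + / h) * (1 + INR n * h)) with (1 + INR n * h + / h + INR n)
            by (field; lra).
          pose proof (pos_INR n); nra.
        - apply Rmult_le_compat_l; lra. }
      assert (Ps : 0 < s ^ n) by now apply pow_lt.
      rewrite pow_inv in Q.
      apply (Rmult_le_compat_r (s ^ n)) in Q; [|lra].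
      rewrite Rmult_assoc, Rinv_l, Rmult_1_r in Q; lra.
  - apply is_lim_seq_const.
  - replace (Finite 0) with (Rbar_mult (1 + / h) 0) by (simpl; f_equal; ring).
    apply is_lim_seq_scal_l, is_lim_seq_geom; rewrite Rabs_pos_eq; lra.
Qed.

Lemma cw_mean_sqr_dev_lim (beta m : R) : 0 <= beta -> cw_magnetization beta m ->
  is_lim_seq (fun n => mean_sqr_dev n m (ising_pmf n beta (Q_CW n))) 0.
Proof.
  intros Hb Hm; apply is_lim_seq_spec; intros eps.
  pose proof (cond_pos eps) as He.
  destruct (cw_rate_gap (Rmax beta 1) m (eps / 2)) as (rho & Hr & Hgap).
  { now apply cw_magnetization_peak. }
  { lra. }
  destruct (proj2 (is_lim_seq_spec _ _) (is_lim_seq_linear_geom rho Hr)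
    (mkposreal (eps / 2) (is_pos_div_2 eps))) as (N & HN).
  exists (S N); intros n Hn. specialize (HN n ltac:(lia)); cbn [pos] in HN.
  rewrite Rminus_0_r in *. apply Rabs_lt_between in HN.
  assert (0 <= mean_sqr_dev n m (ising_pmf n beta (Q_CW n))).
  { unfold mean_sqr_dev.
    apply Rle_trans with (sumR (map (fun z => 0 * ising_pmf n beta (Q_CW n) z) (spins n))).
    - rewrite sumR_map_scal; lra.
    - apply sumR_map_le; intros z Hz; rewrite Rmult_0_l.
      apply Rmult_le_pos; [|apply Rabs_pos].
      apply (ising_pmf_CW n beta); [lia|easy|easy]. }
  rewrite Rabs_pos_eq by easy.
  eapply Rle_lt_trans; [apply (cw_mean_sqr_dev_le n beta (Rmax beta 1) m (eps / 2) rho)|];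
    try easy; try lra; try lia.
  - apply Rmax_l.
  - now apply (cw_magnetization_range beta).
  (* Either the tilt is at [beta] itself, or [m = 0], where [cw_rate] equals 2 at every inverse
     temperature. *)
  - unfold Rmax; destruct (Rle_dec beta 1) as [Hb1|Hb1]; [|easy].
    destruct Hm as [H1 _]; rewrite (H1 Hb1).
    assert (E0 : forall c, cw_rate c 0 = 2); [|now rewrite !E0].
    intros c; unfold cw_rate; replace (c * 0 ^ 2 / 2) with 0 by field.
    rewrite Rmult_0_r, Ropp_0, exp_0; ring.
Qed.

(** * Gaussian integrals *)

Lemma ex_RInt_cont (f : R -> R) (a b : R) : (forall x, continuous f x) -> ex_RInt f a b.
Proof. intros H; apply (ex_RInt_continuous (V := R_CompleteNormedModule)); auto. Qed.

Lemma RInt_ext_R (f g : R -> R) (a b : R) :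
  (forall x, f x = g x) -> RInt f a b = RInt g a b :> R.
Proof. intros H; apply RInt_ext; auto. Qed.

Lemma RInt_point_R (f : R -> R) (a : R) : RInt f a a = 0 :> R.
Proof. exact (RInt_point (V := R_CompleteNormedModule) a f). Qed.

Lemma RInt_const_R (c a b : R) : RInt (fun _ => c) a b = (b - a) * c :> R.
Proof. exact (RInt_const (V := R_CompleteNormedModule) a b c). Qed.

Lemma RInt_Chasles_cont (f : R -> R) (a b c : R) : (forall x, continuous f x) ->
  RInt f a c = RInt f a b + RInt f b c :> R.
Proof.
  intros H; symmetry.
  apply (RInt_Chasles (V := R_CompleteNormedModule)); now apply ex_RInt_cont.
Qed.

Lemma RInt_le_cont (f g : R -> R) (a b : R) : a <= b ->
  (forall x, continuous f x) -> (forall x, continuous g x) ->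
  (forall x, a < x < b -> f x <= g x) -> RInt f a b <= RInt g a b.
Proof. intros Hab Hf Hg H; apply RInt_le; auto using ex_RInt_cont. Qed.

Lemma RInt_ge_0_cont (f : R -> R) (a b : R) : a <= b ->
  (forall x, continuous f x) -> (forall x, 0 <= f x) -> 0 <= RInt f a b.
Proof. intros Hab Hf H; apply RInt_ge_0; auto using ex_RInt_cont. Qed.

Lemma RInt_scal_cont (f : R -> R) (c a b : R) : (forall x, continuous f x) ->
  RInt (fun x => c * f x) a b = c * RInt f a b :> R.
Proof.
  intros H; apply (RInt_scal (V := R_CompleteNormedModule) f); now apply ex_RInt_cont.
Qed.

Lemma RInt_minus_cont (f g : R -> R) (a b : R) :
  (forall x, continuous f x) -> (forall x, continuous g x) ->
  RInt (fun x => f x - g x) a b = RInt f a b - RInt g a b :> R.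
Proof.
  intros Hf Hg; apply (RInt_minus (V := R_CompleteNormedModule) f g); now apply ex_RInt_cont.
Qed.

Lemma continuous_mult_R (f g : R -> R) :
  (forall x, continuous f x) -> (forall x, continuous g x) ->
  forall x, continuous (fun t => f t * g t) x.
Proof. intros Hf Hg x; apply (continuous_mult (K := R_AbsRing) f g); auto. Qed.

Lemma continuous_minus_R (f g : R -> R) :
  (forall x, continuous f x) -> (forall x, continuous g x) ->
  forall x, continuous (fun t => f t - g t) x.
Proof.
  intros Hf Hg x; apply (continuous_minus (V := R_NormedModule) f g); auto.
Qed.

Lemma continuous_Rabs_R (f : R -> R) :
  (forall x, continuous f x) -> forall x, continuous (fun t => Rabs (f t)) x.
Proof. intros Hf x; apply (continuous_comp f Rabs); [auto|apply continuous_Rabs]. Qed.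

Lemma Rabs_RInt_le_cont (f g : R -> R) (a b : R) : a <= b ->
  (forall x, continuous f x) -> (forall x, continuous g x) ->
  (forall x, Rabs (f x) <= g x) -> Rabs (RInt f a b) <= RInt g a b.
Proof.
  intros Hab Hf Hg H; eapply Rle_trans; [apply abs_RInt_le; auto using ex_RInt_cont|].
  apply RInt_le_cont; auto using continuous_Rabs_R.
Qed.

Definition gauss (x : R) : R := exp (- (x * x)).

Lemma continuous_gauss (x : R) : continuous gauss x.
Proof.
  apply (ex_derive_continuous (V := R_NormedModule)); unfold gauss; auto_derive; easy.
Qed.

(** The integrand of the classical evaluation of the Gaussian integral: differentiating in [t]
    cancels the denominator, and at [t = 0] it is the derivative of [atan]. *)
Definition gauss_aux (t x : R) : R := exp (- (t * t * (1 + x * x))) / (1 + x * x).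

Lemma gauss_aux_derive (t x : R) :
  is_derive (fun s => gauss_aux s x) t (- 2 * t * exp (- (t * t * (1 + x * x)))).
Proof.
  unfold gauss_aux; assert (0 < 1 + x * x) by nra.
  auto_derive; [lra|field; lra].
Qed.

Lemma continuous_gauss_aux (t x : R) : continuous (gauss_aux t) x.
Proof.
  apply (ex_derive_continuous (V := R_NormedModule)); unfold gauss_aux.
  assert (0 < 1 + x * x) by nra. auto_derive; lra.
Qed.

(** Joint continuity of the [t]-derivative is what differentiation under the integral sign
    requires. *)
Lemma continuous_2d_gauss_aux_derive (t x : R) :
  continuity_2d_pt (fun u v => - 2 * u * exp (- (u * u * (1 + v * v)))) t x.
Proof.
  apply continuity_2d_pt_mult.
  - apply continuity_2d_pt_mult; [apply continuity_2d_pt_const|apply continuity_2d_pt_id1].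
  - apply (continuity_1d_2d_pt_comp exp).
    + apply derivable_continuous_pt, derivable_pt_exp.
    + apply continuity_2d_pt_opp, continuity_2d_pt_mult.
      * apply continuity_2d_pt_mult; apply continuity_2d_pt_id1.
      * apply continuity_2d_pt_plus; [apply continuity_2d_pt_const|].
        apply continuity_2d_pt_mult; apply continuity_2d_pt_id2.
Qed.

Lemma RInt_gauss_derive (t : R) : is_derive (fun s => RInt gauss 0 s) t (gauss t).
Proof.
  apply (is_derive_RInt (V := R_NormedModule) gauss _ 0); [|apply continuous_gauss].
  apply filter_forall; intros s; apply (RInt_correct (V := R_CompleteNormedModule)).
  apply ex_RInt_cont, continuous_gauss.
Qed.

(** The exponential splits as [exp (- t^2) * exp (- (t x)^2)], and the substitution [u = t x] leaves
    the negative of the derivative of the squared Gaussian integral. *)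
Lemma RInt_gauss_aux_derive (t : R) :
  is_derive (fun s => RInt (gauss_aux s) 0 1) t (- 2 * gauss t * RInt gauss 0 t).
Proof.
  assert (HD : forall s x, Derive (fun u => gauss_aux u x) s
                           = - 2 * s * exp (- (s * s * (1 + x * x)))).
  { intros s x; apply is_derive_unique, gauss_aux_derive. }
  assert (E : RInt (fun x => Derive (fun u => gauss_aux u x) t) 0 1
              = - 2 * gauss t * RInt gauss 0 t :> R).
  (* The [+ 0] matches the affine substitution in [RInt_comp_lin]. *)
  { rewrite (RInt_ext_R _ (fun x => (- 2 * gauss t) * (t * gauss (t * x + 0)))).
    - rewrite RInt_scal_cont.
      + pose proof (RInt_comp_lin (V := R_CompleteNormedModule) gauss t 0 0 1) as L.
        replace (t * 0 + 0) with 0 in L by ring; replace (t * 1 + 0) with t in L by ring.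
        rewrite <- L by (apply ex_RInt_cont, continuous_gauss). easy.
      + intros x; apply (ex_derive_continuous (V := R_NormedModule)); unfold gauss.
        auto_derive; easy.
    - intros x; rewrite HD; unfold gauss.
      transitivity (- 2 * t * (exp (- (t * t)) * exp (- ((t * x + 0) * (t * x + 0))))).
      + rewrite <- exp_plus; f_equal; f_equal; ring.
      + ring. }
  rewrite <- E; apply is_derive_RInt_param.
  - apply filter_forall; intros s x _; eexists; apply gauss_aux_derive.
  - intros x _.
    apply (continuity_2d_pt_ext (fun u v => - 2 * u * exp (- (u * u * (1 + v * v))))).
    + intros u w; now rewrite HD.
    + apply continuous_2d_gauss_aux_derive.
  - apply filter_forall; intros s; apply ex_RInt_cont; intros x; apply continuous_gauss_aux.
Qed.

Lemma RInt_gauss_aux_0 : RInt (gauss_aux 0) 0 1 = PI / 4 :> R.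
Proof.
  apply is_RInt_unique.
  replace (PI / 4) with (minus (atan 1) (atan 0)).
  - apply (is_RInt_derive (V := R_CompleteNormedModule) atan (gauss_aux 0)).
    + intros x _.
      replace (gauss_aux 0 x) with (/ (1 + x ^ 2)); [apply is_derive_Reals, derivable_pt_lim_atan|].
      unfold gauss_aux; replace (- (0 * 0 * (1 + x * x))) with 0 by ring.
      rewrite exp_0; simpl; field; nra.
    + intros x _; apply continuous_gauss_aux.
  - rewrite atan_0, atan_1; unfold minus, plus, opp; simpl; ring.
Qed.

(* [K(t)^2 + H(t)] is constant, where [K(t) = int_0^t exp(-x^2) dx] and
   [H(t) = int_0^1 exp(-t^2 (1+x^2)) / (1+x^2) dx]. *)
Lemma RInt_gauss_sqr (t : R) : 0 < t ->
  RInt gauss 0 t ^ 2 + RInt (gauss_aux t) 0 1 = PI / 4.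
Proof.
  intros Ht; rewrite <- RInt_gauss_aux_0; symmetry.
  pose proof (eq_is_derive (V := R_NormedModule)
    (fun s => RInt gauss 0 s ^ 2 + RInt (gauss_aux s) 0 1) 0 t) as H.
  cbv beta in H; rewrite RInt_point_R in H.
  transitivity (0 ^ 2 + RInt (gauss_aux 0) 0 1); [symmetry; ring|].
  apply H; [|easy]; intros s _.
  assert (Z : 2 * gauss s * RInt gauss 0 s + - 2 * gauss s * RInt gauss 0 s = 0 :> R) by ring.
  assert (D : is_derive (fun u => RInt gauss 0 u ^ 2 + RInt (gauss_aux u) 0 1) s
    (2 * gauss s * RInt gauss 0 s + - 2 * gauss s * RInt gauss 0 s)); [|rewrite Z in D; exact D].
  apply (is_derive_plus (V := R_NormedModule) (fun u => RInt gauss 0 u ^ 2)).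
  - replace (2 * gauss s * RInt gauss 0 s) with (INR 2 * gauss s * RInt gauss 0 s ^ 1)
      by (simpl; ring).
    apply (is_derive_pow (fun u => RInt gauss 0 u) 2), RInt_gauss_derive.
  - apply RInt_gauss_aux_derive.
Qed.

Lemma RInt_gauss_aux_bound (t : R) : 0 <= RInt (gauss_aux t) 0 1 <= gauss t.
Proof.
  assert (B : forall x, 0 <= gauss_aux t x <= gauss t).
  { intros x; unfold gauss_aux, gauss.
    pose proof (exp_pos (- (t * t * (1 + x * x)))) as P.
    assert (Q : exp (- (t * t * (1 + x * x))) <= exp (- (t * t))).
    { destruct (Req_dec (t * x) 0) as [E|E].
      - right; f_equal; replace (t * t * (1 + x * x)) with (t * t + (t * x) * (t * x)) by ring.
        rewrite E; ring.
      - apply Rlt_le, exp_increasing. assert (0 < (t * x) * (t * x)) by nra. nra. }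
    split.
    - apply Rlt_le, Rdiv_lt_0_compat; nra.
    - apply Rle_div_l; [nra|]. pose proof (exp_pos (- (t * t))). nra. }
  split.
  - apply RInt_ge_0_cont; [lra|apply continuous_gauss_aux|apply B].
  - assert (E : RInt (fun _ => gauss t) 0 1 = gauss t :> R) by (rewrite RInt_const_R; ring).
    rewrite <- E; apply RInt_le_cont; [lra|apply continuous_gauss_aux| |intros; apply B].
    intros; apply continuous_const.
Qed.

Lemma RInt_gauss_sym (t : R) : RInt gauss (- t) t = 2 * RInt gauss 0 t :> R.
Proof.
  rewrite (RInt_Chasles_cont gauss (- t) 0 t) by apply continuous_gauss.
  assert (E : RInt gauss (- t) 0 = RInt gauss 0 t :> R).
  { pose proof (RInt_comp_lin (V := R_CompleteNormedModule) gauss (-1) 0 0 t) as L.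
    replace (-1 * 0 + 0) with 0 in L by ring; replace (-1 * t + 0) with (- t) in L by ring.
    rewrite <- (opp_RInt_swap (V := R_CompleteNormedModule) gauss)
      by (apply ex_RInt_cont, continuous_gauss).
    rewrite <- L by (apply ex_RInt_cont, continuous_gauss).
    rewrite (RInt_ext_R _ (fun x => -1 * gauss x)).
    - rewrite RInt_scal_cont by apply continuous_gauss. unfold opp; simpl; ring.
    - intros x; unfold gauss, scal; simpl; unfold mult; simpl.
      f_equal; f_equal; ring. }
  rewrite E; ring.
Qed.

Lemma normal_density_gauss (v x : R) : 0 < v ->
  normal_density v x = / sqrt PI * (/ sqrt (2 * v) * gauss (/ sqrt (2 * v) * x + 0)).
Proof.
  intros Hv; unfold normal_density, gauss.
  assert (Hs : 0 < sqrt (2 * v)) by (apply sqrt_lt_R0; lra).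
  assert (Hp : 0 < sqrt PI) by (apply sqrt_lt_R0, PI_RGT_0).
  assert (E : sqrt (2 * v) * sqrt (2 * v) = 2 * v) by (apply sqrt_sqrt; lra).
  replace (2 * PI * v) with ((2 * v) * PI) by ring.
  rewrite sqrt_mult by (try apply Rlt_le, PI_RGT_0; lra).
  replace ((/ sqrt (2 * v) * x + 0) * (/ sqrt (2 * v) * x + 0)) with (x * x / (2 * v)).
  - replace (- (x * x) / (2 * v)) with (- (x * x / (2 * v))) by (field; lra).
    field; lra.
  - rewrite <- E at 1; field; lra.
Qed.

Lemma continuous_normal_density (v x : R) : 0 < v -> continuous (normal_density v) x.
Proof.
  intros Hv; apply (ex_derive_continuous (V := R_NormedModule)); unfold normal_density.
  assert (0 < sqrt (2 * PI * v)).
  { apply sqrt_lt_R0; pose proof PI_RGT_0; apply Rmult_lt_0_compat; lra. }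
  auto_derive; lra.
Qed.

Lemma normal_density_pos (v x : R) : 0 < v -> 0 < normal_density v x.
Proof.
  intros Hv; apply Rdiv_lt_0_compat; [apply exp_pos|].
  apply sqrt_lt_R0; pose proof PI_RGT_0; apply Rmult_lt_0_compat; lra.
Qed.

(** The square of the mass is [1 - (4 / PI) H(r)] with [r = t / sqrt (2 v)], where [H(r)] is the
    integral of [gauss_aux r] over [[0, 1]]. Here [4 / PI <= 2] and [H(r) <= exp (- r^2) <= 1 / r^2
    = 2 v / t^2]; and the mass, being at most 1, is at least its square. *)
Lemma normal_mass (v t : R) : 0 < v -> 0 < t ->
  1 - 4 * v / t ^ 2 <= RInt (normal_density v) (- t) t <= 1.
Proof.
  intros Hv Ht; set (s := sqrt (2 * v)).
  assert (Hs : 0 < s) by (apply sqrt_lt_R0; lra).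
  assert (Hss : s * s = 2 * v) by (apply sqrt_sqrt; lra).
  pose proof PI_RGT_0 as HPI.
  assert (Hp : 0 < sqrt PI) by now apply sqrt_lt_R0.
  assert (Hpp : sqrt PI * sqrt PI = PI) by (apply sqrt_sqrt; lra).
  set (r := / s * t).
  assert (Hr : 0 < r) by (apply Rmult_lt_0_compat; [now apply Rinv_0_lt_compat|easy]).
  assert (E : RInt (normal_density v) (- t) t = / sqrt PI * (2 * RInt gauss 0 r) :> R).
  { rewrite <- RInt_gauss_sym.
    rewrite (RInt_ext_R _ (fun x => / sqrt PI * (/ s * gauss (/ s * x + 0))))
      by (intros; now apply normal_density_gauss).
    rewrite RInt_scal_cont.
    - f_equal.
      pose proof (RInt_comp_lin (V := R_CompleteNormedModule) gauss (/ s) 0 (- t) t) as L.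
      replace (/ s * - t + 0) with (- r) in L by (unfold r; ring).
      replace (/ s * t + 0) with r in L by (unfold r; ring).
      rewrite <- L by (apply ex_RInt_cont, continuous_gauss). easy.
    - intros x; apply (ex_derive_continuous (V := R_NormedModule)); unfold gauss.
      auto_derive; easy. }
  pose proof (RInt_gauss_sqr r Hr) as HK; pose proof (RInt_gauss_aux_bound r) as HH.
  assert (K0 : 0 <= RInt gauss 0 r).
  { apply RInt_ge_0_cont; [lra|apply continuous_gauss|].
    intros; apply Rlt_le, exp_pos. }
  set (m := RInt (normal_density v) (- t) t) in *.
  assert (Hm0 : 0 <= m).
  { rewrite E; apply Rmult_le_pos; [apply Rlt_le, Rinv_0_lt_compat|]; lra. }
  assert (Hm2 : m ^ 2 = 1 - 4 / PI * RInt (gauss_aux r) 0 1).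
  { rewrite E; replace (RInt (gauss_aux r) 0 1) with (PI / 4 - RInt gauss 0 r ^ 2) by lra.
    assert (F : (/ sqrt PI) ^ 2 = / PI) by (rewrite <- Hpp at 2; field; lra).
    transitivity (4 * RInt gauss 0 r ^ 2 * (/ sqrt PI) ^ 2); [ring|].
    rewrite F; field; lra. }
  assert (H4 : 0 < 4 / PI <= 2).
  { split; [apply Rdiv_lt_0_compat; lra|]. apply Rle_div_l; [lra|].
    pose proof PI2_1; lra. }
  assert (Hg : gauss r <= 2 * v / t ^ 2).
  { unfold gauss; rewrite exp_Ropp.
    replace (2 * v / t ^ 2) with (/ (r * r)) by (unfold r; rewrite <- Hss; field; lra).
    apply Rinv_le_contravar; [nra|]. pose proof (exp_ineq1_le (r * r)); lra. }
  assert (Hm1 : m <= 1) by (destruct (Rle_lt_dec m 1); [easy|nra]).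
  split; [|easy].
  replace (4 * v / t ^ 2) with (2 * (2 * v / t ^ 2)) by (field; lra).
  nra.
Qed.

Lemma normal_mass_le_1 (v a b : R) : 0 < v -> RInt (normal_density v) a b <= 1.
Proof.
  intros Hv; set (t := Rabs a + Rabs b + 1).
  pose proof (Rabs_pos a); pose proof (Rabs_pos b).
  pose proof (Rle_abs a); pose proof (Rle_abs b).
  pose proof (Rle_abs (- a)) as Ka; rewrite Rabs_Ropp in Ka.
  pose proof (Rle_abs (- b)) as Kb; rewrite Rabs_Ropp in Kb.
  assert (C : forall x, continuous (normal_density v) x)
    by (intros; now apply continuous_normal_density).
  assert (P : forall c d, c <= d -> 0 <= RInt (normal_density v) c d).
  { intros c d Hcd; apply RInt_ge_0_cont; try easy.
    intros; now apply Rlt_le, normal_density_pos. }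
  destruct (Rle_lt_dec a b) as [Hab|Hab].
  - apply Rle_trans with (RInt (normal_density v) (- t) t).
    + rewrite (RInt_Chasles_cont _ (- t) a t), (RInt_Chasles_cont _ a b t) by easy.
      assert (0 <= RInt (normal_density v) (- t) a) by (apply P; unfold t; lra).
      assert (0 <= RInt (normal_density v) b t) by (apply P; unfold t; lra). lra.
    + apply normal_mass; [easy|unfold t; lra].
  - pose proof (RInt_Chasles_cont _ a b a C) as Q.
    rewrite RInt_point_R in Q; pose proof (P b a (Rlt_le _ _ Hab)). lra.
Qed.

(** The normal mass of [[a, b]] is at most 1 and that of [[- t, t]] at least [1 - 4 v / t^2], so the
    two outer pieces share at most [4 v / t^2]. *)
Lemma normal_integral_tail (v M a b t : R) (f : R -> R) :
  0 < v -> (forall x, continuous f x) -> (forall x, Rabs (f x) <= M) ->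
  0 < t -> a <= - t -> t <= b ->
  Rabs (RInt (fun x => f x * normal_density v x) a b
        - RInt (fun x => f x * normal_density v x) (- t) t) <= M * (4 * v / t ^ 2).
Proof.
  intros Hv Hf HM Ht Ha Hb.
  assert (C : forall x, continuous (normal_density v) x)
    by (intros; now apply continuous_normal_density).
  assert (CF : forall x, continuous (fun x => f x * normal_density v x) x)
    by now apply continuous_mult_R.
  assert (CM : forall x, continuous (fun x => M * normal_density v x) x)
    by (apply continuous_mult_R; [intros; apply continuous_const|easy]).
  assert (B : forall c d, c <= d -> Rabs (RInt (fun x => f x * normal_density v x) c d)
     <= M * RInt (normal_density v) c d).
  { intros c d Hcd; rewrite <- RInt_scal_cont by easy.
    apply Rabs_RInt_le_cont; try easy; intros x.
    pose proof (normal_density_pos v x Hv).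
    rewrite Rabs_mult, (Rabs_pos_eq (normal_density v x)) by lra.
    apply Rmult_le_compat_r; [lra|easy]. }
  rewrite (RInt_Chasles_cont _ a (- t) b), (RInt_Chasles_cont _ (- t) t b) by easy.
  pose proof (B a (- t) Ha) as B1; pose proof (B t b Hb) as B2.
  pose proof (normal_mass_le_1 v a b Hv) as T.
  rewrite (RInt_Chasles_cont _ a (- t) b), (RInt_Chasles_cont _ (- t) t b) in T by easy.
  destruct (normal_mass v t Hv Ht) as [T2 _].
  assert (HM0 : 0 <= M) by (eapply Rle_trans; [apply Rabs_pos|apply (HM 0)]).
  match goal with |- Rabs ?e <= _ => replace e with
    (RInt (fun x => f x * normal_density v x) a (- t)
     + RInt (fun x => f x * normal_density v x) t b) by ring end.
  eapply Rle_trans; [apply Rabs_triang|].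
  nra.
Qed.

Lemma normal_tail_small (v M eps : R) : 0 < v -> 0 <= M -> 0 < eps ->
  exists t0, 0 < t0 /\ forall t, t0 <= t -> M * (4 * v / t ^ 2) < eps.
Proof.
  (* The summand 1 makes [t <= t^2], so that [t^2] also exceeds [4 v M / eps]. *)
  intros Hv HM He; exists (1 + 4 * v * M / eps).
  assert (P : 0 <= 4 * v * M / eps) by (apply Rdiv_le_0_compat; nra).
  split; [lra|]; intros t Ht.
  replace (M * (4 * v / t ^ 2)) with (4 * v * M / t ^ 2) by (field; lra).
  apply Rlt_div_l; [apply pow_lt; lra|].
  assert (E : 4 * v * M = eps * (4 * v * M / eps)) by (field; lra).
  rewrite E; apply Rmult_lt_compat_l; [easy|]. nra.
Qed.

(** The tail bound makes the integrals over [[- n, n]] a Cauchy sequence. The rate is part of the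
    conclusion because the truncation argument compares [L] with a finite window. *)
Lemma normal_integral_exists (v M : R) (f : R -> R) :
  0 < v -> (forall x, continuous f x) -> (forall x, Rabs (f x) <= M) ->
  exists L, is_RInt_gen (fun x => f x * normal_density v x)
      (Rbar_locally m_infty) (Rbar_locally p_infty) L
    /\ forall t, 0 < t ->
       Rabs (RInt (fun x => f x * normal_density v x) (- t) t - L) <= M * (4 * v / t ^ 2).
Proof.
  intros Hv Hf HM.
  set (F := fun x => f x * normal_density v x).
  assert (CF : forall x, continuous F x).
  { apply continuous_mult_R; [easy|intros; now apply continuous_normal_density]. }
  assert (HM0 : 0 <= M) by (eapply Rle_trans; [apply Rabs_pos|apply (HM 0)]).
  set (I := fun n : nat => RInt F (- INR n) (INR n)).
  assert (HI : ex_finite_lim_seq I).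
  { apply ex_lim_seq_cauchy_corr; intros eps.
    destruct (normal_tail_small v M (eps / 2) Hv HM0 (is_pos_div_2 eps)) as (t0 & Ht0 & Hs).
    destruct (nfloor_ex t0 (Rlt_le _ _ Ht0)) as (N & _ & HN).
    assert (B : forall n, (S N <= n)%nat -> Rabs (I n - I (S N)) < eps / 2).
    { intros n Hn; apply le_INR in Hn; rewrite S_INR in Hn.
      eapply Rle_lt_trans; [apply (normal_integral_tail v M); try easy|apply Hs];
        rewrite ?S_INR; lra. }
    exists (S N); intros n m Hn Hm.
    pose proof (B n Hn) as Bn; pose proof (B m Hm) as Bm.
    apply Rabs_lt_between in Bn, Bm; apply Rabs_lt_between; lra. }
  destruct HI as [L HL].
  assert (Htail : forall t, 0 < t -> Rabs (RInt F (- t) t - L) <= M * (4 * v / t ^ 2)).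
  { intros t Ht; rewrite Rabs_minus_sym.
    apply (is_lim_seq_le_loc (fun n => Rabs (I n - RInt F (- t) t))
      (fun _ => M * (4 * v / t ^ 2)) (Rabs (L - RInt F (- t) t)) (M * (4 * v / t ^ 2))).
    - destruct (nfloor_ex t (Rlt_le _ _ Ht)) as (N & _ & HN).
      exists (S N); intros n Hn; apply le_INR in Hn; rewrite S_INR in Hn.
      apply (normal_integral_tail v M); easy || lra.
    - apply (is_lim_seq_abs _ (Finite (L - RInt F (- t) t))).
      apply is_lim_seq_minus'; [easy|apply is_lim_seq_const].
    - apply is_lim_seq_const. }
  exists L; split; [|exact Htail].
  intros P [eps HP].
  destruct (normal_tail_small v M (eps / 2) Hv HM0 (is_pos_div_2 eps)) as (t & Ht & Hs).
  apply (Filter_prod _ _ _ (fun a => a < - t) (fun b => t < b)).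
  - now exists (- t).
  - now exists t.
  - intros a b Ha Hb; exists (RInt F a b); split.
    + apply (RInt_correct (V := R_CompleteNormedModule)); now apply ex_RInt_cont.
    + apply HP; change (Rabs (RInt F a b - L) < eps).
      assert (Ha' : a <= - t) by lra. assert (Hb' : t <= b) by lra.
      pose proof (normal_integral_tail v M a b t f Hv Hf HM Ht Ha' Hb') as T1.
      fold F in T1.
      pose proof (Htail t Ht) as T2; pose proof (Hs t (Rle_refl t)) as T3.
      replace (RInt F a b - L) with ((RInt F a b - RInt F (- t) t) + (RInt F (- t) t - L)) by ring.
      eapply Rle_lt_trans; [apply Rabs_triang|lra].
Qed.

(** * Stein's equation and weak convergence *)

Lemma normal_density_derive (v x : R) : 0 < v ->
  is_derive (normal_density v) x (- (x / v) * normal_density v x).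
Proof.
  intros Hv; unfold normal_density.
  assert (0 < sqrt (2 * PI * v)).
  { apply sqrt_lt_R0; pose proof PI_RGT_0; apply Rmult_lt_0_compat; lra. }
  auto_derive; [lra|]. unfold Rdiv; field; lra.
Qed.

Lemma RInt_zero_R (f : R -> R) (a b : R) :
  (forall x, Rmin a b < x < Rmax a b -> f x = 0) -> RInt f a b = 0 :> R.
Proof.
  intros H; transitivity (RInt (fun _ => 0) a b); [now apply RInt_ext|].
  rewrite RInt_const_R; ring.
Qed.

(* The solution [G / (v * normal_density v)] of Stein's equation, where [G] is the
   primitive of [h * normal_density v], has compact support because [h] does and has
   Gaussian mean 0. *)
Lemma stein_solution (v r : R) (h : R -> R) : 0 < v -> 0 < r ->
  (forall x, continuous h x) -> (forall x, r <= Rabs x -> h x = 0) ->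
  RInt (fun x => h x * normal_density v x) (- r) r = 0 ->
  exists g g' : R -> R,
    (forall t, is_derive g t (g' t)) /\ (forall t, v * g' t - t * g t = h t) /\
    (forall t, continuous g' t) /\ (forall t, r <= Rabs t -> g' t = 0).
Proof.
  intros Hv Hr Ch Sh H0.
  set (F := fun x => h x * normal_density v x).
  assert (CF : forall x, continuous F x)
    by (apply continuous_mult_R; [easy|intros; now apply continuous_normal_density]).
  set (G := fun w => RInt F (- r) w).
  assert (DG : forall w, is_derive G w (F w)).
  { intros w; apply (is_derive_RInt (V := R_NormedModule) F _ (- r)); [|apply CF].
    apply filter_forall; intros s; apply (RInt_correct (V := R_CompleteNormedModule)).
    now apply ex_RInt_cont. }
  set (g := fun w => G w / (v * normal_density v w)).
  (* Stein's equation solved for the derivative; that [g] has this derivative is the quotient rule,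
     as the density has logarithmic derivative [- w / v]. *)
  set (g' := fun w => (w * g w + h w) / v).
  assert (Dg : forall t, is_derive g t (g' t)).
  { intros t; pose proof (normal_density_pos v t Hv) as P.
    replace (g' t) with ((F t * (v * normal_density v t)
      - G t * (v * (- (t / v) * normal_density v t))) / (v * normal_density v t) ^ 2).
    - apply (is_derive_div G (fun w => v * normal_density v w)); [apply DG| |nra].
      apply (is_derive_scal (normal_density v)); now apply normal_density_derive.
    - unfold g', g, F; field; lra. }
  exists g, g'; split; [exact Dg|]; split; [|split].
  - intros t; unfold g'; field; lra.
  - intros t; apply (continuous_mult_R (fun w => w * g w + h w) (fun _ => / v));
      [|intros; apply continuous_const].
    intros x; apply (continuous_plus (V := R_NormedModule) (fun w => w * g w) h); [|easy].
    apply continuous_mult_R; [intros; apply continuous_id|].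
    intros y; apply (ex_derive_continuous (V := R_NormedModule)); now exists (g' y).
  - intros t Ht; assert (E : G t = 0 :> R).
    { unfold G; destruct (Rle_lt_dec t 0) as [Hl|Hl].
      - rewrite Rabs_left1 in Ht by easy; apply RInt_zero_R; intros x Hx.
        rewrite Rmin_right, Rmax_left in Hx by lra.
        unfold F; rewrite Sh; [ring|rewrite Rabs_left; lra].
      - rewrite Rabs_pos_eq in Ht by lra.
        rewrite (RInt_Chasles_cont F (- r) r t) by easy.
        change (RInt F (- r) r = 0) in H0; rewrite H0.
        rewrite (RInt_zero_R F r t); [ring|intros x Hx].
        rewrite Rmin_left, Rmax_right in Hx by lra.
        unfold F; rewrite Sh; [ring|rewrite Rabs_pos_eq; lra]. }
    unfold g', g; rewrite E, Sh by easy; unfold Rdiv; ring.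
Qed.

Lemma compact_support_bounded (u : R -> R) (r : R) : 0 < r ->
  (forall x, continuous u x) -> (forall x, r <= Rabs x -> u x = 0) ->
  exists B, 0 <= B /\ forall x, Rabs (u x) <= B.
Proof.
  intros Hr Cu Su.
  destruct (continuity_ab_maj (fun x => Rabs (u x)) (- r) r) as (c & Hc & _); [lra| |].
  - intros x _; apply continuity_pt_filterlim; now apply continuous_Rabs_R.
  - exists (Rabs (u c)); split; [apply Rabs_pos|]; intros x.
    destruct (Rle_lt_dec r (Rabs x)) as [H|H].
    + rewrite (Su x H), Rabs_R0; apply Rabs_pos.
    + apply Rabs_lt_between in H; apply Hc; lra.
Qed.

Lemma compact_support_uniform (u : R -> R) (r eps : R) : 0 < r -> 0 < eps ->
  (forall x, continuous u x) -> (forall x, r <= Rabs x -> u x = 0) ->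
  exists d, 0 < d /\ forall s t, Rabs (s - t) < d -> Rabs (u s - u t) <= eps.
Proof.
  intros Hr He Cu Su.
  (* The margin 1, with [d <= 1], ensures that if one point leaves the enlarged interval then [u]
     vanishes at both. *)
  destruct (fun H => @Heine_cor2 u (- (r + 1)) (r + 1) H (mkposreal eps He)) as (d & Hd).
  { intros x _; apply continuity_pt_filterlim, Cu. }
  pose proof (cond_pos d).
  exists (Rmin d 1); split; [apply Rmin_pos; lra|]; intros s t Hst.
  assert (H1 : Rabs (s - t) < d) by (eapply Rlt_le_trans; [exact Hst|apply Rmin_l]).
  assert (H2 : Rabs (s - t) < 1) by (eapply Rlt_le_trans; [exact Hst|apply Rmin_r]).
  destruct (Rle_lt_dec (Rabs s) (r + 1)) as [Hs|Hs];
    destruct (Rle_lt_dec (Rabs t) (r + 1)) as [Ht|Ht].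
  - apply Rabs_le_between in Hs, Ht; apply Rlt_le, (Hd s t); lra.
  - pose proof (Rabs_triang_inv t s) as K; rewrite Rabs_minus_sym in K.
    rewrite (Su s), (Su t), Rminus_diag, Rabs_R0 by lra; lra.
  - pose proof (Rabs_triang_inv s t) as K.
    rewrite (Su s), (Su t), Rminus_diag, Rabs_R0 by lra; lra.
  - rewrite (Su s), (Su t), Rminus_diag, Rabs_R0 by lra; lra.
Qed.

Lemma is_lim_seq_inv_sqrt (c : R) : is_lim_seq (fun n => c / sqrt (INR n)) 0.
Proof.
  replace (Finite 0) with (Rbar_mult c 0) by (simpl; f_equal; ring).
  apply (is_lim_seq_scal_l (fun n => / sqrt (INR n)) c 0).
  replace (Finite 0) with (Rbar_inv p_infty) by easy.
  apply is_lim_seq_inv; [|easy].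
  apply (filterlim_comp _ _ _ INR sqrt _ (Rbar_locally p_infty));
    [apply is_lim_seq_INR|apply filterlim_sqrt_p].
Qed.

Lemma is_lim_seq_inv_INR (c : R) : is_lim_seq (fun n => c / INR n) 0.
Proof.
  replace (Finite 0) with (Rbar_mult c 0) by (simpl; f_equal; ring).
  apply (is_lim_seq_scal_l (fun n => / INR n) c 0).
  replace (Finite 0) with (Rbar_inv p_infty) by easy.
  apply is_lim_seq_inv; [apply is_lim_seq_INR|easy].
Qed.

(** With [h = v g' - w g], the expectation of [h(W)] is minus the error in Stein's identity plus
    [E ((v - A_n) g'(W))], and the latter is at most [sup |g'|] times the mean deviation of
    [A_n]. *)
Lemma stein_limit (beta1 beta2 m1 m2 r : R) (h : R -> R) :
  0 <= beta1 -> 0 <= beta2 ->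
  cw_magnetization beta1 m1 -> cw_magnetization beta2 m2 -> 0 < r ->
  (forall x, continuous h x) -> (forall x, r <= Rabs x -> h x = 0) ->
  RInt (fun x => h x * normal_density ((1 - m1 ^ 2) * (1 - m2 ^ 2)) x) (- r) r = 0 ->
  is_lim_seq (fun n => expect_scaled_cov n beta1 beta2 h) 0.
Proof.
  intros Hb1 Hb2 Hm1 Hm2 Hr Ch Sh H0.
  pose proof (cw_magnetization_range beta1 m1 Hm1) as R1.
  pose proof (cw_magnetization_range beta2 m2 Hm2) as R2.
  set (v := (1 - m1 ^ 2) * (1 - m2 ^ 2)) in *.
  assert (Hv : 0 < v) by (apply Rmult_lt_0_compat; nra).
  destruct (stein_solution v r h Hv Hr Ch Sh H0) as (g & g' & Dg & Eg & Cg & Sg).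
  destruct (compact_support_bounded g' r Hr Cg Sg) as (B & HB0 & HB).
  set (p := fun n => ising_pmf n beta1 (Q_CW n)).
  set (q := fun n => ising_pmf n beta2 (Q_CW n)).
  set (dev := fun n => mean_sqr_dev n m1 (p n) + mean_sqr_dev n m2 (q n)
                       + 4 / INR n + 5 / sqrt (INR n)).
  assert (Ldev : is_lim_seq dev 0).
  { replace (Finite 0) with (Finite (0 + 0 + 0 + 0)) by (f_equal; ring).
    apply is_lim_seq_plus'; [|apply is_lim_seq_inv_sqrt].
    apply is_lim_seq_plus'; [|apply is_lim_seq_inv_INR].
    apply is_lim_seq_plus'; now apply cw_mean_sqr_dev_lim. }
  apply is_lim_seq_spec; intros eps; pose proof (cond_pos eps) as He.
  (* Stein's identity loses a factor 4, so its share is [eps / 4]. The deviation of [A_n] gets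
     [eps / 2], with [B + 1] in the denominator because [B] may be 0. *)
  destruct (compact_support_uniform g' r (eps / 16) Hr) as (d & Hd & Ug); try easy; [lra|].
  assert (Hbe : 0 < eps / (2 * (B + 1))) by (apply Rdiv_lt_0_compat; lra).
  destruct (proj2 (is_lim_seq_spec _ _) Ldev (mkposreal _ Hbe)) as (N1 & HN1).
  destruct (proj2 (is_lim_seq_spec _ _) (is_lim_seq_inv_sqrt 4) (mkposreal d Hd)) as (N2 & HN2).
  exists (S (N1 + N2)); intros n Hn.
  specialize (HN1 n ltac:(lia)); specialize (HN2 n ltac:(lia)); cbn [pos] in HN1, HN2.
  rewrite Rminus_0_r in *.
  assert (Hn0 : (0 < n)%nat) by lia.
  pose proof (ising_pmf_CW n beta1 Hn0 Hb1) as Pp; fold (p n) in Pp.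
  pose proof (ising_pmf_CW n beta2 Hn0 Hb2) as Pq; fold (q n) in Pq.
  pose proof (ising_pmf_CW_swap n beta1) as Ps; fold (p n) in Ps.
  pose proof (stein_identity n (p n) (q n) g g' (eps / 16) Hn0 Pp Pq Ps Dg) as St.
  assert (Q4 : 0 <= 4 / sqrt (INR n)).
  { apply Rdiv_le_0_compat; [lra|]. now apply sqrt_lt_R0, INR_gt_0. }
  rewrite Rabs_pos_eq in HN2 by easy.
  specialize (St ltac:(intros s t Hst; apply Ug; lra)).
  assert (Dv : expect2 n (p n) (q n) (fun x y => Rabs (A_n n x y - v)) <= dev n)
    by (apply expect2_A_dev; try easy; nra).
  assert (E : expect_scaled_cov n beta1 beta2 h
    = -1 * expect2 n (p n) (q n) (fun x y => W_n n x y * g (W_n n x y) - A_n n x y * g' (W_n n x y))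
      + expect2 n (p n) (q n) (fun x y => (v - A_n n x y) * g' (W_n n x y))).
  { rewrite <- expect2_scal, <- expect2_plus.
    change (expect_scaled_cov n beta1 beta2 h)
      with (expect2 n (p n) (q n) (fun x y => h (W_n n x y))).
    apply expect2_ext; intros x y _ _; rewrite <- Eg; ring. }
  assert (T : Rabs (expect2 n (p n) (q n) (fun x y => (v - A_n n x y) * g' (W_n n x y)))
    <= B * dev n).
  { apply Rle_trans with (expect2 n (p n) (q n) (fun x y => B * Rabs (A_n n x y - v))).
    - apply expect2_Rabs_le; try easy; intros x y _ _.
      rewrite Rabs_mult, Rabs_minus_sym, Rmult_comm.
      apply Rmult_le_compat_r; [apply Rabs_pos|apply HB].
    - rewrite expect2_scal; now apply Rmult_le_compat_l. }
  apply Rabs_lt_between in HN1.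
  assert (T2 : B * dev n <= (B + 1) * (eps / (2 * (B + 1)))).
  { apply Rle_trans with (B * (eps / (2 * (B + 1)))); [apply Rmult_le_compat_l; lra|].
    apply Rmult_le_compat_r; lra. }
  replace ((B + 1) * (eps / (2 * (B + 1)))) with (eps / 2) in T2 by (field; lra).
  rewrite E; eapply Rle_lt_trans; [apply Rabs_triang|].
  rewrite Rabs_mult, (Rabs_left (-1)) by lra. lra.
Qed.

(** The trapezoid equal to 1 on [[- A, A]], to 0 outside [[- (A + 1), A + 1]] and affine between;
    absolute values make it continuous by composition. *)
Definition cutoff (A x : R) : R := (Rabs (A + 1 - Rabs x) - Rabs (A - Rabs x) + 1) / 2.

Lemma continuous_cutoff (A x : R) : continuous (cutoff A) x.
Proof.
  unfold cutoff.
  assert (C : forall c x, continuous (fun t => Rabs (c - Rabs t)) x).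
  { intros c; apply continuous_Rabs_R, continuous_minus_R;
      [intros; apply continuous_const|apply continuous_Rabs]. }
  apply (continuous_mult_R (fun t => Rabs (A + 1 - Rabs t) - Rabs (A - Rabs t) + 1) (fun _ => / 2));
    [|intros; apply continuous_const].
  intros y; apply (continuous_plus (V := R_NormedModule)
    (fun t => Rabs (A + 1 - Rabs t) - Rabs (A - Rabs t))); [|apply continuous_const].
  now apply continuous_minus_R.
Qed.

Lemma cutoff_range (A x : R) : 0 <= cutoff A x <= 1.
Proof.
  unfold cutoff; generalize (Rabs x); intros a; unfold Rabs.
  destruct (Rcase_abs (A + 1 - a)), (Rcase_abs (A - a)); lra.
Qed.

Lemma cutoff_in (A x : R) : Rabs x <= A -> cutoff A x = 1.
Proof.
  intros H; unfold cutoff; rewrite (Rabs_pos_eq (A + 1 - Rabs x)), (Rabs_pos_eq (A - Rabs x)); lra.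
Qed.

Lemma cutoff_out (A x : R) : A + 1 <= Rabs x -> cutoff A x = 0.
Proof.
  intros H; unfold cutoff; rewrite (Rabs_left1 (A + 1 - Rabs x)), (Rabs_left1 (A - Rabs x)); lra.
Qed.

Lemma normal_cutoff_mass (v A : R) : 0 < v -> 0 < A ->
  1 - 4 * v / A ^ 2
  <= RInt (fun x => cutoff A x * normal_density v x) (- (A + 1)) (A + 1) <= 1.
Proof.
  intros Hv HA.
  assert (C : forall x, continuous (normal_density v) x)
    by (intros; now apply continuous_normal_density).
  assert (CP : forall x, continuous (fun x => cutoff A x * normal_density v x) x)
    by (apply continuous_mult_R; [apply continuous_cutoff|easy]).
  assert (P : forall x, 0 <= cutoff A x * normal_density v x <= normal_density v x).
  { intros x; pose proof (cutoff_range A x); pose proof (normal_density_pos v x Hv); nra. }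
  split.
  - eapply Rle_trans; [apply normal_mass; [exact Hv|exact HA]|].
    rewrite (RInt_Chasles_cont _ (- (A + 1)) (- A) (A + 1)), (RInt_Chasles_cont _ (- A) A (A + 1))
      by easy.
    set (F := fun x => cutoff A x * normal_density v x) in *.
    assert (0 <= RInt F (- (A + 1)) (- A)) by (apply RInt_ge_0_cont; [lra|easy|apply P]).
    assert (0 <= RInt F A (A + 1)) by (apply RInt_ge_0_cont; [lra|easy|apply P]).
    assert (RInt (normal_density v) (- A) A <= RInt F (- A) A); [|lra].
    apply RInt_le_cont; [lra|easy|easy|]; intros x Hx.
    unfold F; rewrite cutoff_in; [lra|apply Rabs_le; lra].
  - eapply Rle_trans; [|apply (normal_mass_le_1 v (- (A + 1)) (A + 1) Hv)].
    apply RInt_le_cont; [lra|easy|easy|]; intros x _; apply P.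
Qed.

(** Decompose [f = (f - c) * cutoff + (f - c) * (1 - cutoff) + c]. The first part has compact
    support and, by the choice of [c], zero Gaussian mean; the second is small by Chebyshev's
    inequality; and [c] is close to the Gaussian integral [L] of [f]. *)
Lemma cw_covariance_clt (beta1 beta2 m1 m2 : R) :
  0 <= beta1 -> 0 <= beta2 ->
  cw_magnetization beta1 m1 -> cw_magnetization beta2 m2 ->
  converges_in_dist_to_normal
    (fun n f => expect_scaled_cov n beta1 beta2 f) ((1 - m1 ^ 2) * (1 - m2 ^ 2)).
Proof.
  intros Hb1 Hb2 Hm1 Hm2 f Cf (M & HM).
  pose proof (cw_magnetization_range beta1 m1 Hm1) as R1.
  pose proof (cw_magnetization_range beta2 m2 Hm2) as R2.
  set (v := (1 - m1 ^ 2) * (1 - m2 ^ 2)).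
  assert (Hv : 0 < v) by (apply Rmult_lt_0_compat; nra).
  assert (HM0 : 0 <= M) by (eapply Rle_trans; [apply Rabs_pos|apply (HM 0)]).
  destruct (normal_integral_exists v M f Hv Cf HM) as (L & HL & HLt).
  exists L; split; [exact HL|].
  apply is_lim_seq_spec; intros eps; pose proof (cond_pos eps) as He.
  (* Three errors of [eps / 12] make up the bound [eps / 4] on [|c - L|]; the second threshold [t2]
     keeps the mass [P] of the cutoff above 1/2. *)
  destruct (normal_tail_small v M (eps / 12) Hv HM0) as (t1 & Ht1 & S1); [lra|].
  destruct (normal_tail_small v 1 (1 / 2) Hv) as (t2 & Ht2 & S2); [lra|lra|].
  (* Used as a plain inequality: the value 2 in place of the variance gives [8 M / A^2], the
     Chebyshev bound from [|f - c| <= 2 M] and [E W^2 <= 4]. *)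
  destruct (normal_tail_small 2 M (eps / 4)) as (t3 & Ht3 & S3); [lra|easy|lra|].
  set (A := t1 + t2 + t3).
  assert (HA : 0 < A) by (unfold A; lra).
  specialize (S2 A ltac:(unfold A; lra)); specialize (S3 A ltac:(unfold A; lra)).
  assert (S1R := S1 (A + 1) ltac:(unfold A; lra)); specialize (S1 A ltac:(unfold A; lra)).
  set (r := A + 1) in *; assert (Hr : 0 < r) by (unfold r; lra).
  assert (C : forall x, continuous (normal_density v) x)
    by (intros; now apply continuous_normal_density).
  assert (Cc := continuous_cutoff A).
  set (P := RInt (fun x => cutoff A x * normal_density v x) (- r) r).
  set (I := RInt (fun x => f x * cutoff A x * normal_density v x) (- r) r).
  assert (CP : forall x, continuous (fun x => cutoff A x * normal_density v x) x)
    by now apply continuous_mult_R.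
  assert (CI : forall x, continuous (fun x => f x * cutoff A x * normal_density v x) x)
    by (apply (continuous_mult_R (fun x => f x * cutoff A x)); [now apply continuous_mult_R|easy]).
  assert (CN : forall x, continuous (fun x => f x * normal_density v x) x)
    by now apply continuous_mult_R.
  pose proof (normal_cutoff_mass v A Hv HA) as HP; fold r P in HP.
  assert (HP0 : 0 < P) by lra.
  (* [c] is the mean of [f] under the normal density reweighted by the cutoff, so the integral of
     [(f - c) * cutoff] against the density is [I - c * P = 0]. *)
  set (c := I / P).
  assert (EcP : c * P = I) by (unfold c; field; lra).
  assert (HI : Rabs I <= M * P).
  { unfold I, P; rewrite <- RInt_scal_cont by easy.
    apply Rabs_RInt_le_cont; [lra|easy|now apply continuous_mult_R; [intros; apply continuous_const|]|].
    intros x; pose proof (cutoff_range A x); pose proof (normal_density_pos v x Hv).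
    rewrite Rmult_assoc, Rabs_mult, (Rabs_pos_eq (cutoff A x * normal_density v x)) by nra.
    apply Rmult_le_compat_r; [nra|easy]. }
  assert (Hc : Rabs c <= M).
  { unfold c, Rdiv; rewrite Rabs_mult, Rabs_inv, (Rabs_pos_eq P) by lra.
    apply Rle_div_l; lra. }
  assert (HIf : Rabs (I - RInt (fun x => f x * normal_density v x) (- r) r) <= M * (1 - P)).
  { pose proof (normal_mass_le_1 v (- r) r Hv) as Hm.
    apply Rle_trans with (M * (RInt (normal_density v) (- r) r - P));
      [|apply Rmult_le_compat_l; lra].
    unfold I, P; rewrite <- !RInt_minus_cont by easy.
    rewrite <- RInt_scal_cont by now apply continuous_minus_R.
    apply Rabs_RInt_le_cont; [lra|now apply continuous_minus_R| |].
    - apply continuous_mult_R; [intros; apply continuous_const|now apply continuous_minus_R].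
    - intros x; pose proof (cutoff_range A x); pose proof (normal_density_pos v x Hv).
      replace (f x * cutoff A x * normal_density v x - f x * normal_density v x)
        with (f x * - ((1 - cutoff A x) * normal_density v x)) by ring.
      replace (normal_density v x - cutoff A x * normal_density v x)
        with ((1 - cutoff A x) * normal_density v x) by ring.
      rewrite Rabs_mult, Rabs_Ropp, (Rabs_pos_eq ((1 - cutoff A x) * _)) by nra.
      apply Rmult_le_compat_r; [nra|easy]. }
  assert (HMP : M * (1 - P) < eps / 12).
  { eapply Rle_lt_trans; [|exact S1]. apply Rmult_le_compat_l; lra. }
  assert (HcL : Rabs (c - L) < eps / 4).
  { specialize (HLt r Hr).
    (* From [c * P = I]: the errors are the missing cutoff mass, the effect of the cutoff on the
       integral of [f], and the Gaussian tail beyond [r]. *)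
    replace (c - L) with (c * (1 - P) + ((I - RInt (fun x => f x * normal_density v x) (- r) r)
      + (RInt (fun x => f x * normal_density v x) (- r) r - L))) by (rewrite <- EcP; ring).
    assert (Rabs (c * (1 - P)) <= M * (1 - P)).
    { rewrite Rabs_mult, (Rabs_pos_eq (1 - P)) by lra. apply Rmult_le_compat_r; lra. }
    eapply Rle_lt_trans; [apply Rabs_triang|].
    eapply Rle_lt_trans; [apply Rplus_le_compat_l, Rabs_triang|]. lra. }
  set (h := fun x => (f x - c) * cutoff A x).
  assert (Ch : forall x, continuous h x).
  { apply continuous_mult_R; [|easy]. apply continuous_minus_R; [easy|].
    intros; apply continuous_const. }
  assert (Lh : is_lim_seq (fun n => expect_scaled_cov n beta1 beta2 h) 0).
  { apply (stein_limit beta1 beta2 m1 m2 r); try easy.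
    - intros x Hx; unfold h; rewrite cutoff_out by easy; ring.
    - fold v; rewrite (RInt_ext_R _ (fun x => f x * cutoff A x * normal_density v x
        - c * (cutoff A x * normal_density v x))) by (intros; unfold h; ring).
      rewrite RInt_minus_cont, RInt_scal_cont; try easy.
      + fold I P; lra.
      + apply continuous_mult_R; [intros; apply continuous_const|easy]. }
  destruct (proj2 (is_lim_seq_spec _ _) Lh (mkposreal _ (is_pos_div_2 eps))) as (N & HN).
  exists (S N); intros n Hn; specialize (HN n ltac:(lia)); cbn [pos] in HN.
  rewrite Rminus_0_r in HN.
  assert (Hn0 : (0 < n)%nat) by lia.
  set (p := ising_pmf n beta1 (Q_CW n)); set (q := ising_pmf n beta2 (Q_CW n)).
  pose proof (ising_pmf_CW n beta1 Hn0 Hb1) as Pp; fold p in Pp.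
  pose proof (ising_pmf_CW n beta2 Hn0 Hb2) as Pq; fold q in Pq.
  pose proof (ising_pmf_CW_swap n beta1) as Ps; fold p in Ps.
  pose proof (expect2_W_sqr_le n p q Hn0 Pp Pq Ps) as HW.
  assert (E : expect_scaled_cov n beta1 beta2 f
    = expect_scaled_cov n beta1 beta2 h
      + (expect2 n p q (fun x y => (f (W_n n x y) - c) * (1 - cutoff A (W_n n x y))) + c)).
  { rewrite <- (expect2_const n p q c) at 1 by easy.
    rewrite <- expect2_plus.
    change (expect_scaled_cov n beta1 beta2 h) with (expect2 n p q (fun x y => h (W_n n x y))).
    rewrite <- expect2_plus.
    change (expect_scaled_cov n beta1 beta2 f) with (expect2 n p q (fun x y => f (W_n n x y))).
    apply expect2_ext; intros; unfold h; ring. }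
  assert (T : Rabs (expect2 n p q (fun x y => (f (W_n n x y) - c) * (1 - cutoff A (W_n n x y))))
     <= M * (4 * 2 / A ^ 2)).
  { assert (HA2 : 0 < A ^ 2) by now apply pow_lt.
    apply Rle_trans with (expect2 n p q (fun x y => (2 * M / A ^ 2) * W_n n x y ^ 2)).
    - apply expect2_Rabs_le; try easy; intros x y _ _; set (w := W_n n x y).
      assert (B : Rabs (f w - c) <= 2 * M).
      { unfold Rminus; eapply Rle_trans; [apply Rabs_triang|].
        rewrite Rabs_Ropp; pose proof (HM w); lra. }
      pose proof (cutoff_range A w) as K.
      rewrite Rabs_mult, (Rabs_pos_eq (1 - _)) by lra.
      replace (2 * M / A ^ 2 * w ^ 2) with (2 * M * (w ^ 2 / A ^ 2)) by (field; lra).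
      apply Rmult_le_compat; [apply Rabs_pos|lra|easy|].
      (* Chebyshev's inequality pointwise: [1 - cutoff A w <= w^2 / A^2]. *)
      destruct (Rle_lt_dec (Rabs w) A) as [Hw|Hw].
      + rewrite cutoff_in by easy.
        assert (0 <= w ^ 2 / A ^ 2); [|lra].
        apply Rdiv_le_0_compat; [apply pow2_ge_0|easy].
      + assert (1 <= w ^ 2 / A ^ 2); [|lra].
        apply Rle_div_r; [easy|]. rewrite <- (pow2_abs w), Rmult_1_l; apply pow_incr; lra.
    - rewrite expect2_scal.
      replace (M * (4 * 2 / A ^ 2)) with (2 * M / A ^ 2 * 4) by (field; lra).
      apply Rmult_le_compat_l; [|easy]. apply Rdiv_le_0_compat; lra. }
  rewrite E.
  match goal with |- Rabs (?a + (?b + c) - L) < _ =>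
    replace (a + (b + c) - L) with (a + (b + (c - L))) by ring end.
  eapply Rle_lt_trans; [apply Rabs_triang|].
  eapply Rle_lt_trans; [apply Rplus_le_compat_l, Rabs_triang|]. lra.
Qed.

Lemma cw_variance_factor (beta m : R) : cw_magnetization beta m ->
  0 < 1 - m ^ 2 <= 1 /\ (1 < beta -> 1 - m ^ 2 < 1) /\ (beta <= 1 -> 1 - m ^ 2 = 1).
Proof.
  intros H; pose proof (cw_magnetization_range beta m H); destruct H as [H1 H2].
  split; [nra|]; split; intros Hb.
  - destruct (H2 Hb); nra.
  - rewrite (H1 Hb); ring.
Qed.

Theorem theorem2 (beta1 beta2 m1 m2 : R) :
  0 <= beta1 -> 0 <= beta2 ->
  cw_magnetization beta1 m1 -> cw_magnetization beta2 m2 ->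
  converges_in_dist_to_normal
    (fun n f => expect_scaled_cov n beta1 beta2 f) ((1 - m1 ^ 2) * (1 - m2 ^ 2))
  /\ ((1 - m1 ^ 2) * (1 - m2 ^ 2) = 1 <-> beta1 <= 1 /\ beta2 <= 1)
  /\ (~ (beta1 <= 1 /\ beta2 <= 1) -> (1 - m1 ^ 2) * (1 - m2 ^ 2) < 1).
Proof.
  intros Hb1 Hb2 Hm1 Hm2.
  split; [now apply cw_covariance_clt|].
  destruct (cw_variance_factor beta1 m1 Hm1) as (P1 & Q1 & E1).
  destruct (cw_variance_factor beta2 m2 Hm2) as (P2 & Q2 & E2).
  set (a := 1 - m1 ^ 2) in *; set (b := 1 - m2 ^ 2) in *.
  assert (Hlt : ~ (beta1 <= 1 /\ beta2 <= 1) -> a * b < 1).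
  { intros H; destruct (Rle_lt_dec beta1 1) as [H1|H1].
    - assert (H2 : 1 < beta2) by (apply Rnot_le_lt; tauto). specialize (Q2 H2); nra.
    - specialize (Q1 H1); nra. }
  split; [split|exact Hlt].
  - intros Hab; destruct (Rle_lt_dec beta1 1) as [H1|H1];
      destruct (Rle_lt_dec beta2 1) as [H2|H2]; [easy|exfalso..];
      assert (a * b < 1) by (apply Hlt; lra); lra.
  - intros [H1 H2]; rewrite (E1 H1), (E2 H2); ring.
Qed.
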